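(* Let $p$ be a prime, $d\ge 1$ a natural number, and $\sigma,b$ positive real numbers. Let $\vec X$ be the max-norm process in $\mathbb{Q}_p^d$ with diffusion constant $\sigma$ and diffusion exponent $b$, and for $i\in\{1,\dots,d\}$ let $X^{(i)}$ be the stochastic process given by the $i$-th component of $\vec X$. Then for every $i\in\{1,\dots,d\}$, the process $X^{(i)}$ is a Brownian motion in $\mathbb{Q}_p$ with diffusion constant $\sigma$ and diffusion exponent $b$.
   Context: $|\cdot|$ is the $p$-adic absolute value on $\mathbb{Q}_p$, and $\|\vec x\|=\max_{1\le i\le d}|x_i|$ is the max-norm on $\mathbb{Q}_p^d$. $\mu_d$ is the Haar measure on $\mathbb{Q}_p^d$ normalized by $\mu_d(\mathbb{Z}_p^d)=1$, and $d\vec y$ denotes integration against $\mu_d$. $\chi(x)=e^{2\pi\sqrt{-1}\{x\}}$ is the standard additive character of $\mathbb{Q}_p$, where $\{x\}$ is the fractional part of $x$, that is, $\{x\}=\sum_{k<0}a_x(k)p^k$ for the $p$-adic expansion $x=\sum_{k}a_x(k)p^k$ with digits $a_x(k)\in\{0,\dots,p-1\}$. Write $\vec x\cdot\vec y=\sum_i x_iy_i$. For $t>0$ put $\rho_d(t,\vec x)=\int_{\mathbb{Q}_p^d}\chi(\vec x\cdot\vec y)\,e^{-\sigma t\|\vec y\|^b}\,d\vec y$; this is a probability density on $\mathbb{Q}_p^d$ and is the fundamental solution of the $p$-adic diffusion equation $\frac{df}{dt}=-\sigma\Delta_{b,d}f$, where $\Delta_{b,d}$ is the Fourier multiplier operator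 with symbol $\|\cdot\|^b$. $D([0,\infty):\mathbb{Q}_p^d)$ is the Skorohod space of càdlàg paths $\omega:[0,\infty)\to\mathbb{Q}_p^d$. $P^d$ is the probability measure on this space that is concentrated on paths with $\omega(0)=\vec 0$ and for which the increments over disjoint time intervals are independent, the increment $\omega(t)-\omega(s)$, $0\le s<t$, having density $\rho_d(t-s,\cdot)$ with respect to $\mu_d$. The max-norm process is $\vec X(t,\omega)=\vec X_t(\omega)=\omega(t)$ under $P^d$. The Brownian motion in $\mathbb{Q}_p$ with diffusion constant $\sigma$ and diffusion exponent $b$ is this process for $d=1$; a process with càdlàg paths in $\mathbb{Q}_p$ is called such a Brownian motion if its law is $P=P^1$. *)

(* Defs.v *)
From HB Require Import structures.
From mathcomp Require Import all_boot all_order all_algebra ring_quotient complex ring lra.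
From mathcomp Require Import all_classical all_reals all_analysis.

Set Implicit Arguments.
Unset Strict Implicit.
Unset Printing Implicit Defensive.

Import Order.TTheory GRing.Theory Num.Theory.
Import numFieldTopology.Exports.

Local Open Scope classical_set_scope.
Local Open Scope ring_scope.

(* |n / d| = p ^ (v(d) - v(n)), where v is the p-adic valuation logn p. *)
Definition padic_absq (p : nat) (x : rat) : rat :=
  if x == 0 then 0
  else p%:R ^ ((logn p `|denq x|)%:Z - (logn p `|numq x|)%:Z).

Section padic_absq_theory.
Variables (p : nat) (p_pr : prime p).
Local Notation v := (padic_absq p).

Let p0 : (0 : rat) < p%:R. Proof. by rewrite ltr0n prime_gt0. Qed.
Let p1 : (1 : rat) < p%:R. Proof. by rewrite ltr1n prime_gt1. Qed.

Lemma padic_absq0 : v 0 = 0. Proof. by rewrite /padic_absq eqxx. Qed.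

Lemma padic_absq_ge0 x : 0 <= v x.
Proof. by rewrite /padic_absq; case: (eqVneq x 0) => // _; rewrite exprz_ge0 ?ltW. Qed.

Lemma padic_absq_eq0 x : (v x == 0) = (x == 0).
Proof.
by rewrite /padic_absq; case: (eqVneq x 0) => [_|_]; rewrite ?eqxx// gt_eqF ?exprz_gt0.
Qed.

Lemma padic_absq_frac (n d : int) : n != 0 -> d != 0 ->
  v (n%:~R / d%:~R) = p%:R ^ ((logn p `|d|)%:Z - (logn p `|n|)%:Z).
Proof.
move=> n0 d0; rewrite /padic_absq.
have [|x0] := eqVneq (n%:~R / d%:~R : rat) 0.
  by move/eqP; rewrite mulf_eq0 invr_eq0 !intr_eq0 (negPf n0) (negPf d0).
set x := _ / _; congr (_ ^ _).
have nx0 : numq x != 0 by rewrite numq_eq0.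
have E : numq x * d = n * denq x.
  apply/eqP; rewrite -(eqr_int rat) !rmorphM /= -[x in numq x]/x.
  have := divq_num_den x; move/(canRL (mulfVK _)) => -> //=; last first.
    by rewrite intr_eq0 denq_neq0.
  by rewrite /x mulrAC divfK ?intr_eq0.
have := congr1 (fun z : int => logn p `|z|%N) E.
rewrite !abszM !lognM ?absz_gt0 ?denq_neq0// => /(congr1 Posz).
rewrite !PoszD => H; apply/eqP.
by rewrite subr_eq addrAC eq_sym subr_eq addrC H addrC.
Qed.

Lemma padic_absqM : {morph v : x y / x * y}.
Proof.
move=> x y; have [->|x0] := eqVneq x 0; first by rewrite mul0r padic_absq0 mul0r.
have [->|y0] := eqVneq y 0; first by rewrite mulr0 padic_absq0 mulr0.
have nx := x0; have ny := y0; rewrite -numq_eq0 in nx; rewrite -numq_eq0 in ny.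
have -> : x * y = (numq x * numq y)%:~R / (denq x * denq y)%:~R.
  by rewrite -{1}[x]divq_num_den -{1}[y]divq_num_den !rmorphM/= mulf_div.
rewrite padic_absq_frac ?mulf_neq0 ?denq_neq0//.
rewrite /padic_absq (negPf x0) (negPf y0) -expfzDr ?(gt_eqF p0)//.
congr (_ ^ _); rewrite !abszM !lognM ?absz_gt0 ?denq_neq0// !PoszD.
by rewrite opprD addrACA.
Qed.

Lemma padic_absq1 : v 1 = 1.
Proof. by rewrite -[1 in LHS](divr1 1) (@padic_absq_frac 1 1)// subrr expr0z. Qed.

Lemma padic_absqN x : v (- x) = v x.
Proof. by rewrite /padic_absq oppr_eq0 denqN numqN abszN. Qed.

Lemma padic_absqB x y : v (x - y) = v (y - x).
Proof. by rewrite -padic_absqN opprB. Qed.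

Lemma padic_absqV x : v (x^-1) = (v x)^-1.
Proof.
have [->|x0] := eqVneq x 0; first by rewrite !(invr0, padic_absq0).
have vx0 : v x != 0 by rewrite padic_absq_eq0.
by apply: (mulfI vx0); rewrite -padic_absqM !divff// padic_absq1.
Qed.

Lemma padic_absqD x y : v (x + y) <= Num.max (v x) (v y).
Proof.
have [->|x0] := eqVneq x 0; first by rewrite add0r le_max lexx orbT.
have [->|y0] := eqVneq y 0; first by rewrite addr0 le_max lexx.
have [->|xy0] := eqVneq (x + y) 0.
  by rewrite padic_absq0 le_max padic_absq_ge0.
have nx := x0; have ny := y0; rewrite -numq_eq0 in nx; rewrite -numq_eq0 in ny.
have dxy : (denq x * denq y != 0) by rewrite mulf_neq0 ?denq_neq0.
pose a := numq x * denq y; pose b := numq y * denq x.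
have Ex : x = a%:~R / (denq x * denq y)%:~R.
  rewrite -{1}[x]divq_num_den !rmorphM/= -mulf_div divff ?mulr1//.
  by rewrite intr_eq0 denq_neq0.
have Ey : y = b%:~R / (denq x * denq y)%:~R.
  rewrite -{1}[y]divq_num_den [denq x * _]mulrC !rmorphM/= -mulf_div divff ?mulr1//.
  by rewrite intr_eq0 denq_neq0.
have a0 : a != 0 by rewrite mulf_neq0 ?denq_neq0.
have b0 : b != 0 by rewrite mulf_neq0 ?denq_neq0.
have Exy : x + y = (a + b)%:~R / (denq x * denq y)%:~R.
  by rewrite rmorphD/= mulrDl -Ex -Ey.
have ab0 : a + b != 0.
  by apply: contraNneq xy0 => ab; rewrite Exy ab mul0r.
have vx : v x = _ := etrans (congr1 v Ex) (padic_absq_frac a0 dxy).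
have vy : v y = _ := etrans (congr1 v Ey) (padic_absq_frac b0 dxy).
rewrite vx vy Exy padic_absq_frac//.
rewrite le_max !ler_eXz2l// !lerD2l !lerN2 !lez_nat -geq_min.
rewrite -pfactor_dvdn ?absz_gt0//.
have /dvdzP[k kE] : ((p ^ minn (logn p `|a|) (logn p `|b|))%N%:Z %| a)%Z.
  by rewrite dvdzE /= pfactor_dvdn ?absz_gt0// geq_minl.
have /dvdzP[l lE] : ((p ^ minn (logn p `|a|) (logn p `|b|))%N%:Z %| b)%Z.
  by rewrite dvdzE /= pfactor_dvdn ?absz_gt0// geq_minr.
have -> : a + b = (k + l) * (p ^ minn (logn p `|a|) (logn p `|b|))%N%:Z.
  by rewrite mulrDl -kE -lE.
by rewrite abszM dvdn_mull.
Qed.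

End padic_absq_theory.

(* Qp is the completion of the rationals: the ring of p-adic Cauchy sequences
   modulo the ideal of null sequences. The primality proof p_pr is an argument
   of the types so that the instances below can be inferred. *)
Definition padic_cauchy (p : nat) (p_pr : prime p) : {pred nat -> rat} :=
  fun u => `[< forall e : rat, 0 < e -> exists N : nat, forall m n : nat,
    (N <= m)%N -> (N <= n)%N -> padic_absq p (u m - u n) < e >].

Section padic_cauchy_closed.
Variables (p : nat) (p_pr : prime p).
Local Notation v := (padic_absq p).

Lemma padic_absq_isosceles (a b : rat) : v (a - b) < v b -> v a = v b.
Proof.
move=> ab; apply/eqP; rewrite eq_le; apply/andP; split.
  rewrite -{1}[a](subrK b); apply: le_trans (padic_absqD p_pr _ _) _.
  by rewrite ge_max lexx (ltW ab).
have := padic_absqD p_pr (b - a) a; rewrite subrK le_max => /orP[|//].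
by rewrite padic_absqB// leNgt ab.
Qed.

Lemma padic_cauchy_bounded (u : nat -> rat) : u \in padic_cauchy p_pr ->
  exists C : rat, 0 < C /\ exists N : nat, forall n, (N <= n)%N -> v (u n) <= C.
Proof.
move=> /asboolP/(_ 1 ltr01)[N uN].
exists (Num.max 1 (v (u N))); split; first by rewrite lt_max ltr01.
exists N => n Nn; rewrite -[u n](subrK (u N)).
apply: le_trans (padic_absqD p_pr _ _) _.
by rewrite ge_max !le_max lexx orbT andbT ltW// uN.
Qed.

Lemma padic_cauchy_subring : subring_closed (padic_cauchy p_pr).
Proof.
split.
- apply/asboolP => e e0; exists 0%N => m n _ _.
  by rewrite [X in v X](_ : _ = 0) ?padic_absq0//; rewrite /= subrr.
- move=> f g /asboolP fC /asboolP gC; apply/asboolP => e e0.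
  have [N fN] := fC e e0; have [M gM] := gC e e0.
  exists (maxn N M) => m n; rewrite !geq_max => /andP[Nm Mm] /andP[Nn Mn].
  rewrite [X in v X](_ : _ = (f m - f n) + (g n - g m)); last first.
    by rewrite !fctE; ring.
  apply: le_lt_trans (padic_absqD p_pr _ _) _.
  by rewrite gt_max fN// gM.
- move=> f g fC gC.
  have [C [C0 [N fN]]] := padic_cauchy_bounded fC.
  have [D [D0 [M gM]]] := padic_cauchy_bounded gC.
  move/asboolP in fC; move/asboolP in gC; apply/asboolP => e e0.
  have [N' fN'] := fC (e / D) (divr_gt0 e0 D0).
  have [M' gM'] := gC (e / C) (divr_gt0 e0 C0).
  exists (maxn (maxn N M) (maxn N' M')) => m n.
  rewrite !geq_max => /andP[/andP[Nm Mm] /andP[Nm' Mm']].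
  move=> /andP[/andP[Nn Mn] /andP[Nn' Mn']].
  rewrite [X in v X](_ : _ = (f m - f n) * g m + f n * (g m - g n)); last first.
    by rewrite !fctE; ring.
  apply: le_lt_trans (padic_absqD p_pr _ _) _.
  rewrite gt_max !padic_absqM//; apply/andP; split.
        apply: (le_lt_trans (ler_wpM2l (padic_absq_ge0 p _) (gM _ Mm))).
    by rewrite -ltr_pdivlMr// fN'.
  apply: (le_lt_trans (ler_wpM2r (padic_absq_ge0 p _) (fN _ Nn))).
  by rewrite mulrC -ltr_pdivlMr// gM'.
Qed.

HB.instance Definition _ := GRing.isSubringClosed.Build (nat -> rat)
  (padic_cauchy p_pr) padic_cauchy_subring.

End padic_cauchy_closed.

Record padic_cauchy_seq (p : nat) (p_pr : prime p) := PadicCauchySeq {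
  padic_seq :> nat -> rat ;
  padic_seqP : padic_seq \in padic_cauchy p_pr }.

Section padic_cauchy_seq_ring.
Variables (p : nat) (p_pr : prime p).
HB.instance Definition _ := [isSub for (@padic_seq p p_pr)].
HB.instance Definition _ := [Choice of padic_cauchy_seq p_pr by <:].
HB.instance Definition _ :=
  [SubChoice_isSubComNzRing of padic_cauchy_seq p_pr by <:].
End padic_cauchy_seq_ring.

Definition padic_null (p : nat) (p_pr : prime p) :
    {pred padic_cauchy_seq p_pr} :=
  fun u => `[< forall e : rat, 0 < e -> exists N : nat, forall n : nat,
    (N <= n)%N -> padic_absq p (u n) < e >].
Arguments padic_null {p} p_pr _.

Section padic_null_ideal.
Variables (p : nat) (p_pr : prime p).
Local Notation v := (padic_absq p).

Lemma padic_null_idealr : idealr_closed (padic_null p_pr).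
Proof.
split.
- apply/asboolP => e e0; exists 0%N => n _.
  by rewrite [X in v X](_ : _ = 0) ?padic_absq0.
- apply/asboolP => /(_ 1 ltr01)[N /(_ N (leqnn N))].
  by rewrite [X in v X](_ : _ = 1) ?padic_absq1// ltxx.
- move=> a f g /asboolP fC /asboolP gC; apply/asboolP => e e0.
  have [C [C0 [L aL]]] := padic_cauchy_bounded (valP a).
  have [N fN] := fC (e / C) (divr_gt0 e0 C0); have [M gM] := gC e e0.
  exists (maxn L (maxn N M)) => n; rewrite !geq_max => /and3P[Ln Nn Mn].
  rewrite [X in v X](_ : _ = a n * f n + g n)//.
  apply: le_lt_trans (padic_absqD p_pr _ _) _.
  rewrite gt_max gM// andbT padic_absqM//.
  apply: (le_lt_trans (ler_wpM2r (padic_absq_ge0 p _) (aL _ Ln))).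
  by rewrite mulrC -ltr_pdivlMr// fN.
Qed.

HB.instance Definition _ :=
  isIdealr.Build (padic_cauchy_seq p_pr) (padic_null p_pr) padic_null_idealr.

End padic_null_ideal.

Definition Qp (p : nat) (p_pr : prime p) := {ideal_quot padic_null p_pr}.

Section Qp_ring.
Variables (p : nat) (p_pr : prime p).
HB.instance Definition _ := GRing.ComNzRing.on (Qp p_pr).
End Qp_ring.

(* The values of the p-adic absolute value are rational, so that rat serves as
   the value field of this absolute value and of the metric of Qp. *)
Definition padic_abs (p : nat) (p_pr : prime p) (x : Qp p_pr) : rat :=
  lim ((padic_absq p (repr x n) : rat^o) @[n --> \oo]).

Section padic_abs_theory.
Local Open Scope quotient_scope.
Variables (p : nat) (p_pr : prime p).
Local Notation v := (padic_absq p).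
Implicit Types (x y : Qp p_pr) (u : padic_cauchy_seq p_pr).
Local Notation piQ := (\pi_(Qp p_pr)).

Lemma Qp_pi_eq0 u : (piQ u == 0) = (u \in padic_null p_pr).
Proof.
have -> : (0 : Qp p_pr) = piQ 0 by rewrite rmorph0.
by rewrite -Quotient.idealrBE subr0.
Qed.

Lemma padic_notnull u : u \notin padic_null p_pr ->
  exists2 c, 0 < c & exists N, forall n, (N <= n)%N -> v (u n) = c.
Proof.
move=> /asboolP/existsNP[e]/not_implyP[e0 /forallNP ue].
have /asboolP/(_ e e0)[N uN] := padic_seqP u.
have /existsNP[m /not_implyP[Nm /negP]] := ue N; rewrite -leNgt => eu.
exists (v (u m)); first exact: lt_le_trans eu.
exists N => n Nn; apply: padic_absq_isosceles => //.
by apply: lt_le_trans eu; exact: uN.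
Qed.

Lemma padic_abs0 : padic_abs (0 : Qp p_pr) = 0.
Proof.
rewrite /padic_abs. apply: (@cvg_lim rat^o); first exact: Rhausdorff.
have /asboolP H : repr (0 : Qp p_pr) \in padic_null p_pr.
  by rewrite -Qp_pi_eq0 reprK.
apply/cvgrPdist_lt => e /H[N uN]; exists N => // n /= Nn.
by rewrite sub0r normrN ger0_norm ?padic_absq_ge0// uN.
Qed.

Lemma padic_abs_eventually u : piQ u != 0 ->
  0 < padic_abs (piQ u) /\
  exists N, forall n, (N <= n)%N -> v (u n) = padic_abs (piQ u).
Proof.
move=> u0; set x := piQ u; set w := repr x.
have wu : w - u \in padic_null p_pr.
  by rewrite Quotient.idealrBE; apply/eqP; rewrite reprK.
have : w \notin padic_null p_pr by rewrite -Qp_pi_eq0 reprK.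
move=> /padic_notnull[c c0 [N wN]].
have -> : padic_abs x = c.
  rewrite /padic_abs; apply: (@cvg_lim rat^o); first exact: Rhausdorff.
  by apply: cvg_near_cst; exists N => // n /= Nn; rewrite wN.
split => //; have /asboolP/(_ c c0)[M wM] := wu.
exists (maxn N M) => n; rewrite geq_max => /andP[Nn Mn].
rewrite -(wN n Nn); apply: (padic_absq_isosceles p_pr).
by rewrite wN// padic_absqB// wM.
Qed.

Lemma padic_abs_ge0 x : 0 <= padic_abs x.
Proof.
have [->|x0] := eqVneq x 0; first by rewrite padic_abs0.
by move: x0; rewrite -[x]reprK => /padic_abs_eventually[/ltW].
Qed.

Lemma padic_abs_eq0 x : padic_abs x = 0 -> x = 0.
Proof.
have [//|] := eqVneq x 0.
by rewrite -[x]reprK => /padic_abs_eventually[+ _] => /gt_eqF/eqP.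
Qed.

Lemma padic_absN x : padic_abs (- x) = padic_abs x.
Proof.
have [->|] := eqVneq x 0; first by rewrite oppr0.
rewrite -[x]reprK -rmorphN => x0.
have [_ [N xN]] := padic_abs_eventually x0.
have [|_ [M xM]] := @padic_abs_eventually (- repr x); first by rewrite rmorphN oppr_eq0.
by rewrite -(xN (maxn N M)) ?leq_maxl// -(xM (maxn N M)) ?leq_maxr// padic_absqN.
Qed.

Lemma padic_absD x y : padic_abs (x + y) <= Num.max (padic_abs x) (padic_abs y).
Proof.
have [->|] := eqVneq (x + y) 0; first by rewrite padic_abs0 le_max padic_abs_ge0.
have [->|] := eqVneq x 0; first by rewrite add0r le_max lexx orbT.
have [->|] := eqVneq y 0; first by rewrite addr0 le_max lexx.
rewrite -[x]reprK -[y]reprK -rmorphD => y0 x0 xy0.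
have [_ [N xN]] := padic_abs_eventually x0.
have [_ [M yM]] := padic_abs_eventually y0.
have [_ [L xyL]] := padic_abs_eventually xy0.
set k := maxn N (maxn M L).
have [kN kM kL] : [/\ (N <= k)%N, (M <= k)%N & (L <= k)%N].
  by split; rewrite !leq_max leqnn ?orbT.
by rewrite -(xN k)// -(yM k)// -(xyL k)//; exact: padic_absqD.
Qed.

Lemma Qp_inv_ex x : x != 0 -> exists y, y * x = 1.
Proof.
rewrite -[x]reprK; set u := repr x => u0.
have := u0; rewrite Qp_pi_eq0 => /padic_notnull[c c0 [N uN]].
pose w := fun n => (u n)^-1.
have wC : w \in padic_cauchy p_pr.
  apply/asboolP => e e0; have /asboolP := padic_seqP u.
  move=> /(_ (e * c * c) (mulr_gt0 (mulr_gt0 e0 c0) c0))[M uM].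
  exists (maxn N M) => m n; rewrite !geq_max => /andP[Nm Mm] /andP[Nn Mn].
  have u_neq0 k : (N <= k)%N -> u k != 0.
    by move=> Nk; rewrite -(padic_absq_eq0 p_pr) uN// gt_eqF.
  rewrite /w [X in v X](_ : _ = (u n - u m) / (u m * u n)); last first.
    by field; rewrite !u_neq0.
  rewrite padic_absqM// padic_absqV// padic_absqM// !uN//.
  by rewrite ltr_pdivrMr ?mulr_gt0// mulrA uM.
exists (piQ (PadicCauchySeq wC)); apply/eqP.
rewrite -rmorphM -subr_eq0.
have -> : (1 : Qp p_pr) = piQ 1 by rewrite rmorph1.
rewrite -rmorphB Qp_pi_eq0; apply/asboolP => e e0; exists N => n Nn.
rewrite [X in v X](_ : _ = w n * u n - 1)// /w mulVf ?subrr ?padic_absq0//.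
by rewrite -(padic_absq_eq0 p_pr) uN// gt_eqF.
Qed.

Definition Qp_inv x : Qp p_pr := xget 0 [set y | y * x = 1].

Lemma Qp_mulVf x : x != 0 -> Qp_inv x * x = 1.
Proof.
by move=> /Qp_inv_ex[y yx]; rewrite /Qp_inv; case: xgetP => [_ -> //|/(_ y)].
Qed.

Lemma Qp_inv0 : Qp_inv 0 = 0.
Proof.
rewrite /Qp_inv; case: xgetP => [z _ /=|//].
by rewrite mulr0 => /esym/eqP; rewrite oner_eq0.
Qed.

HB.instance Definition _ :=
  GRing.ComNzRing_isField.Build (Qp p_pr) Qp_mulVf Qp_inv0.

Definition Qp_dist x y := padic_abs (x - y).

Lemma Qp_distxx x : Qp_dist x x = 0.
Proof. by rewrite /Qp_dist subrr padic_abs0. Qed.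

Lemma Qp_dist_eq0 x y : Qp_dist x y = 0 -> x = y.
Proof. by move=> /padic_abs_eq0/eqP; rewrite subr_eq0 => /eqP. Qed.

Lemma Qp_distC x y : Qp_dist x y = Qp_dist y x.
Proof. by rewrite /Qp_dist -padic_absN opprB. Qed.

Lemma Qp_dist_triangle y x z : Qp_dist x z <= Qp_dist x y + Qp_dist y z.
Proof.
rewrite /Qp_dist -[x in x - z](subrK y) -addrA.
apply: le_trans (padic_absD _ _) _.
by rewrite ge_max lerDl lerDr !padic_abs_ge0.
Qed.

HB.instance Definition _ := isMetric.Build rat (Qp p_pr)
  Qp_distxx Qp_dist_eq0 Qp_distC Qp_dist_triangle.
HB.instance Definition _ := isPointed.Build (Qp p_pr) 0.

End padic_abs_theory.

(* The Borel sigma-algebra is that of the product topology of 'rV, which is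
   the topology of the max-norm. *)
Definition Qpd (p : nat) (p_pr : prime p) (d : nat) :=
  g_sigma_algebraType (@open 'rV[Qp p_pr]_d).

HB.instance Definition _ (p : nat) (p_pr : prime p) (d : nat) :=
  Measurable.on (Qpd p_pr d).

Definition max_norm (p : nat) (p_pr : prime p) (d : nat) (x : Qpd p_pr d) :
    rat :=
  \big[Num.max/0]_(i < d) padic_abs (x 0 i).

Definition dotQp (p : nat) (p_pr : prime p) (d : nat) (x y : Qpd p_pr d) :
    Qp p_pr :=
  \sum_(i < d) x 0 i * y 0 i.

(* A translation-invariant Borel measure with mu(Zp^d) = 1 is finite on compact
   sets, and regular because Qp^d is second countable: it is a Haar measure. *)
Definition is_normalized_haar (R : realType) (p : nat) (p_pr : prime p) (d : nat)
    (mu : {measure set (Qpd p_pr d) -> \bar R}) : Prop :=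
  mu [set x | forall i, padic_abs (x 0 i) <= 1] = 1%E /\
  forall (a : Qpd p_pr d) (B : set (Qpd p_pr d)), measurable B ->
    mu [set a + x | x in B] = mu B.

(* The sums over k are finite because a k = 0 for k small. *)
Definition is_padic_expansion (p : nat) (p_pr : prime p) (x : Qp p_pr)
    (a : int -> nat) : Prop :=
  [/\ forall k, (a k < p)%N,
      exists m : int, forall k, k < m -> a k = 0%N &
      \sum_(k \in [set k : int | k < n%:Z]) (a k)%:R * (p%:R : Qp p_pr) ^ k
        @[n --> \oo] --> x].

(* Every x has exactly one expansion. *)
Definition padic_digits (p : nat) (p_pr : prime p) (x : Qp p_pr) :
    int -> nat :=
  xget (fun=> 0%N) (is_padic_expansion x).

Definition padic_frac (p : nat) (p_pr : prime p) (x : Qp p_pr) : rat :=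
  \sum_(k \in [set k : int | k < 0]) (padic_digits x k)%:R * (p%:R : rat) ^ k.

Definition expi (R : realType) (theta : R) : R[i] :=
  Complex (cos theta) (sin theta).

Definition padic_char (R : realType) (p : nat) (p_pr : prime p)
    (x : Qp p_pr) : R[i] :=
  expi (2 * pi * ratr (padic_frac x)).

Definition Cintegral (R : realType) (dT : measure_display)
    (T : measurableType dT) (mu : {measure set T -> \bar R}) (D : set T)
    (f : T -> R[i]) : R[i] :=
  Complex (\int[mu]_(x in D) complex.Re (f x))
          (\int[mu]_(x in D) complex.Im (f x)).

Definition rho (R : realType) (p : nat) (p_pr : prime p) (d : nat)
    (mu : {measure set (Qpd p_pr d) -> \bar R}) (sigma b t : R)
    (x : Qpd p_pr d) : R[i] :=
  Cintegral mu setT (fun y =>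
    padic_char R (dotQp x y) *
    real_complex R (expR (- sigma * t * ratr (max_norm y) `^ b))).

(* The time set [0, oo[ is {nonneg R}. Close to t on the right, and also on the
   left if t > 0, |r| is r. *)
Definition cadlag (R : realType) (V : topologicalType) (w : {nonneg R} -> V) :
    Prop :=
  (forall t : {nonneg R}, w (`|r|%:nng) @[r --> t%:num^'+] --> w t) /\
  (forall t : {nonneg R}, 0 < t%:num ->
    exists l : V, w (`|r|%:nng) @[r --> t%:num^'-] --> l).

Record cadlag_path (R : realType) (p : nat) (p_pr : prime p) (d : nat) :=
  CadlagPath {
    path_fun :> {nonneg R} -> 'rV[Qp p_pr]_d ;
    path_cadlag : cadlag path_fun }.

Section cadlag_path_pointed.
Variables (R : realType) (p : nat) (p_pr : prime p) (d : nat).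

Lemma cadlag_cst0 : cadlag ((fun=> 0) : {nonneg R} -> 'rV[Qp p_pr]_d).
Proof. by split=> [t|t _]; [exact: cvg_cst|exists 0; exact: cvg_cst]. Qed.

HB.instance Definition _ := gen_eqMixin (cadlag_path R p_pr d).
HB.instance Definition _ := gen_choiceMixin (cadlag_path R p_pr d).
HB.instance Definition _ :=
  isPointed.Build (cadlag_path R p_pr d) (CadlagPath cadlag_cst0).
End cadlag_path_pointed.

(* This sigma-algebra is the Borel sigma-algebra of the Skorohod topology,
   because Qp^d is a complete separable metric space. *)
Definition path_cylinder (R : realType) (p : nat) (p_pr : prime p) (d : nat) :
    set (set (cadlag_path R p_pr d)) :=
  [set A | exists (t : {nonneg R}) (B : set (Qpd p_pr d)),
    measurable B /\ A = [set w : cadlag_path R p_pr d | B (w t)]].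

Definition skorohod (R : realType) (p : nat) (p_pr : prime p) (d : nat) :=
  g_sigma_algebraType (@path_cylinder R p p_pr d).

HB.instance Definition _ (R : realType) (p : nat) (p_pr : prime p) (d : nat) :=
  Measurable.on (skorohod R p_pr d).

Definition coord_process (R : realType) (p : nat) (p_pr : prime p) (d : nat)
    (t : {nonneg R}) (w : skorohod R p_pr d) : 'rV[Qp p_pr]_d :=
  path_fun w t.

Definition increment (R : realType) (p : nat) (p_pr : prime p) (d : nat)
    (s t : {nonneg R}) (w : skorohod R p_pr d) : 'rV[Qp p_pr]_d :=
  coord_process t w - coord_process s w.

Definition independent_increments (R : realType) (p : nat) (p_pr : prime p)
    (d : nat) (P : probability (skorohod R p_pr d) R) : Prop :=
  forall (n : nat) (s t : 'I_n -> {nonneg R}) (B : 'I_n -> set (Qpd p_pr d)),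
    (forall k, (s k)%:num < (t k)%:num) ->
    (forall j k, j != k ->
      (t j)%:num <= (s k)%:num \/ (t k)%:num <= (s j)%:num) ->
    (forall k, measurable (B k)) ->
    P [set w | forall k, B k (increment (s k) (t k) w)] =
    (\prod_(k < n) P [set w | B k (increment (s k) (t k) w)])%E.

(* P is the law P^d of the max-norm process. The density condition is an equality
   of complex numbers because rho is defined as a complex integral. *)
Definition is_max_norm_law (R : realType) (p : nat) (p_pr : prime p) (d : nat)
    (mu : {measure set (Qpd p_pr d) -> \bar R}) (sigma b : R)
    (P : probability (skorohod R p_pr d) R) : Prop :=
  [/\ P [set w | coord_process (0%:nng) w = 0] = 1%E,
      independent_increments P &
      forall (s t : {nonneg R}) (B : set (Qpd p_pr d)),
        s%:num < t%:num -> measurable B ->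
        real_complex R
          (fine (P [set w | B (increment s t w)])) =
        Cintegral mu B (rho mu sigma b (t%:num - s%:num))].

(* Qp is identified with Qp^1 by const_mx. The existence of X says that the paths
   of Y are cadlag and that w |-> Y _ w is measurable; distribution P X is the law
   of Y on the path space. *)
Definition is_brownian_motion (R : realType) (p : nat) (p_pr : prime p)
    (mu : {measure set (Qpd p_pr 1) -> \bar R}) (sigma b : R)
    (dT : measure_display) (T : measurableType dT) (P : probability T R)
    (Y : {nonneg R} -> T -> Qp p_pr) : Prop :=
  exists X : {mfun T >-> skorohod R p_pr 1},
    (forall t w, coord_process t (X w) = const_mx (Y t w)) /\
    is_max_norm_law mu sigma b (distribution P X).

(* Main.v *)
Require Import Defs.
From HB Require Import structures.
From mathcomp Require Import all_boot all_order all_algebra ring_quotient complex ring lra.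
From mathcomp Require Import all_classical all_reals all_analysis measurable_realfun.

(** The symbol exp(- sigma t N(y)^b), with N the max-norm, is a decreasing function of N(y),
    and N takes only the values 0 and p^k. Summation by parts therefore writes it as a
    mixture over k in Z of the indicators of the balls of radius p^k, with weights
    g(k) - g(k + 1) >= 0, where g(k) is the value of the symbol on the sphere of radius
    p^k ([level_mixture]). These weights are the same in every dimension.

    The Fourier transform of the indicator of the ball of radius p^k is p^(dk) times the
    indicator of the ball of radius p^(- k) ([Rintegral_ball_cos_in],
    [Rintegral_ball_sin_in] and [Rintegral_ball_out]). As that ball has volume p^(- dk), the
    density rho_d(t, .) is the mixture, with those weights, of the uniform probability
    laws on the balls of radius p^(- k) ([rhoE], [Cintegral_rho]).

    A coordinate sends the uniform law on a ball of Qp^d to the uniform law on the ball of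
    the same radius in Qp ([haar_coord]): the image is still invariant under translations,
    and an invariant measure on a ball is determined by its total mass, because it
    shares that mass equally between the cosets of each smaller ball
    ([ball_invariant_unique]). Hence the i-th coordinate of an increment has density
    rho_1(t, .). The coordinate map is additive and continuous, so the starting point, the
    independence of the increments and the cadlag property pass to the component, and
    the component is a Brownian motion.

    The arithmetic input is that the character is a homomorphism ([padic_fracD]), trivial
    on Zp ([padic_frac_int]) and nontrivial at every point outside
    Zp ([cos_padic_angle_neq1]); all three rest on the existence of digit expansions. *)

Set Implicit Arguments.
Unset Strict Implicit.
Unset Printing Implicit Defensive.

Import Order.TTheory GRing.Theory Num.Theory.
Import numFieldTopology.Exports.

Local Open Scope classical_set_scope.
Local Open Scope ring_scope.

(** * Rational numbers and digits in Qp *)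

Section Qp_rationals.
Variables (p : nat) (p_pr : prime p).
Local Open Scope quotient_scope.
Local Notation piQ := (\pi_(Qp p_pr)).

Lemma cst_padic_cauchy (q : rat) : (fun=> q) \in padic_cauchy p_pr.
Proof. by apply/asboolP => e e0; exists 0%N => m n _ _; rewrite subrr padic_absq0. Qed.

Definition Qp_of_rat (q : rat) : Qp p_pr := piQ (PadicCauchySeq (cst_padic_cauchy q)).

Lemma Qp_of_rat_is_additive : zmod_morphism Qp_of_rat.
Proof.
move=> x y; rewrite /Qp_of_rat -rmorphB; congr (piQ _).
exact: val_inj.
Qed.

Lemma Qp_of_rat_is_multiplicative : monoid_morphism Qp_of_rat.
Proof.
split.
  rewrite /Qp_of_rat (_ : PadicCauchySeq _ = 1) ?rmorph1//; exact: val_inj.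
move=> x y; rewrite /Qp_of_rat -rmorphM; congr (piQ _).
exact: val_inj.
Qed.

HB.instance Definition _ := GRing.isZmodMorphism.Build rat (Qp p_pr) Qp_of_rat
  Qp_of_rat_is_additive.
HB.instance Definition _ := GRing.isMonoidMorphism.Build rat (Qp p_pr) Qp_of_rat
  Qp_of_rat_is_multiplicative.

Lemma padic_abs_rat (q : rat) : padic_abs (Qp_of_rat q) = padic_absq p q.
Proof.
have [->|q0] := eqVneq q 0; first by rewrite rmorph0 padic_abs0 padic_absq0.
have H : Qp_of_rat q != 0 by rewrite fmorph_eq0.
by have [_ [N /(_ N (leqnn N))]] := padic_abs_eventually H.
Qed.

Lemma padic_abs_gt0 (x : Qp p_pr) : x != 0 -> 0 < padic_abs x.
Proof.
by move=> x0; rewrite lt0r padic_abs_ge0 andbT; apply: contra_neq x0 => /padic_abs_eq0.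
Qed.

Lemma Qp_dense (x : Qp p_pr) (e : rat) : 0 < e -> exists q : rat, padic_abs (x - Qp_of_rat q) < e.
Proof.
move=> e0.
have /asboolP/(_ e e0)[N xN] := padic_seqP (repr x).
exists (repr x N).
have [->|] := eqVneq (x - Qp_of_rat (repr x N)) 0; first by rewrite padic_abs0.
rewrite -{1 3}[x]reprK -rmorphB => /padic_abs_eventually[_ [M /(_ (maxn N M) (leq_maxr _ _)) <-]].
by apply: xN; rewrite ?leq_maxl.
Qed.

Lemma padic_abs1 : padic_abs (1 : Qp p_pr) = 1.
Proof. by rewrite -(rmorph1 Qp_of_rat) padic_abs_rat padic_absq1. Qed.

(** Far enough along the representing sequences, all three absolute values are
    rational ones, where multiplicativity is known. *)
Lemma padic_absM (x y : Qp p_pr) : padic_abs (x * y) = padic_abs x * padic_abs y.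
Proof.
have [->|x0] := eqVneq x 0; first by rewrite mul0r padic_abs0 mul0r.
have [->|y0] := eqVneq y 0; first by rewrite mulr0 padic_abs0 mulr0.
have := mulf_neq0 x0 y0; move: x0 y0.
rewrite -[x]reprK -[y]reprK -rmorphM => x0 y0 xy0.
have [_ [N xN]] := padic_abs_eventually x0.
have [_ [M yM]] := padic_abs_eventually y0.
have [_ [L xyL]] := padic_abs_eventually xy0.
set k := maxn N (maxn M L).
have [kN kM kL] : [/\ (N <= k)%N, (M <= k)%N & (L <= k)%N].
  by split; rewrite !leq_max leqnn ?orbT.
by rewrite -(xN k)// -(yM k)// -(xyL k)//; exact: padic_absqM.
Qed.

Lemma padic_absV (x : Qp p_pr) : padic_abs x^-1 = (padic_abs x)^-1.
Proof.
have [->|x0] := eqVneq x 0; first by rewrite invr0 padic_abs0 invr0.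
have vx0 : padic_abs x != 0 by rewrite gt_eqF ?padic_abs_gt0.
by apply: (mulfI vx0); rewrite -padic_absM !divff// padic_abs1.
Qed.

Lemma padic_abs_nat_le1 (n : nat) : padic_abs (n%:R : Qp p_pr) <= 1.
Proof.
elim: n => [|n IH]; first by rewrite padic_abs0.
rewrite -natr1; apply: le_trans (padic_absD _ _) _.
by rewrite ge_max IH padic_abs1 lexx.
Qed.

Lemma padic_abs_p : padic_abs (p%:R : Qp p_pr) = p%:R^-1.
Proof.
rewrite -(rmorph_nat Qp_of_rat) padic_abs_rat.
have := @padic_absq_frac p p%:Z 1.
rewrite divr1 pmulrn => -> //; last by rewrite -lt0n prime_gt0.
by rewrite /= logn1 logn_prime// eqxx sub0r -invr_expz expr1z.
Qed.

Lemma Qp_p_neq0 : (p%:R : Qp p_pr) != 0.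
Proof. by rewrite -(rmorph_nat Qp_of_rat) fmorph_eq0 pnatr_eq0 -lt0n prime_gt0. Qed.

Lemma padic_abs_pX (k : int) : padic_abs ((p%:R : Qp p_pr) ^ k) = p%:R ^ (- k).
Proof.
case: k => n.
  elim: n => [|n IH]; first by rewrite !expr0z padic_abs1.
  rewrite -exprnP exprS padic_absM padic_abs_p exprnP IH.
  by rewrite -!invr_expz -!exprnP exprS invfM.
rewrite NegzE -invr_expz padic_absV; elim: n.+1 => {n}[|n IH].
  by rewrite !expr0z padic_abs1 invr1.
rewrite -exprnP exprS padic_absM padic_abs_p exprnP invfM invrK IH.
by rewrite !opprK -!exprnP exprS.
Qed.

Lemma padic_absB_le (x y : Qp p_pr) (c : rat) : padic_abs x <= c -> padic_abs y <= c ->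
  padic_abs (x - y) <= c.
Proof.
by move=> xc yc; apply: le_trans (padic_absD _ _) _; rewrite ge_max xc padic_absN.
Qed.

Lemma padic_absD_le (x y : Qp p_pr) (c : rat) : padic_abs x <= c -> padic_abs y <= c ->
  padic_abs (x + y) <= c.
Proof.
by move=> xc yc; apply: le_trans (padic_absD _ _) _; rewrite ge_max xc.
Qed.

Lemma padic_abs_val (x : Qp p_pr) : x != 0 -> exists k : int, padic_abs x = p%:R ^ k.
Proof.
rewrite -[x]reprK => x0; have [x1 [N /(_ N (leqnn N))]] := padic_abs_eventually x0.
move: x1 => /[swap] <-; rewrite /padic_absq; case: ifP => [_|_ _]; first by rewrite ltxx.
by eexists; reflexivity.
Qed.

(** If p divided the denominator, the bound would force it to divide the numerator
    as well, against coprimality. *)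
Lemma padic_absq_le1_denq (q : rat) : padic_absq p q <= 1 -> coprime p `|denq q|.
Proof.
rewrite /padic_absq; case: eqVneq => [->|q0]; first by rewrite coprimen1.
rewrite -[X in _ <= X](expr0z p%:R) ler_eXz2l ?ltr1n ?prime_gt1// subr_le0 lez_nat => dn.
rewrite prime_coprime// -[p in (p %| _)%N]expn1 pfactor_dvdn ?absz_gt0 ?denq_neq0//.
apply/negP => d1; have n1 := leq_trans d1 dn.
have := coprime_num_den q; rewrite coprime_sym.
have pd : (p %| `|denq q|)%N.
  by rewrite -[p in (p %| _)%N]expn1 pfactor_dvdn ?absz_gt0 ?denq_neq0.
have pn : (p %| `|numq q|)%N.
  by rewrite -[p in (p %| _)%N]expn1 pfactor_dvdn ?absz_gt0 ?numq_eq0.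
have : (p %| gcdn `|denq q| `|numq q|)%N by rewrite dvdn_gcd pd.
rewrite /coprime => /[swap] /eqP ->.
by rewrite dvdn1 => /eqP p1; move: (prime_gt1 p_pr); rewrite p1.
Qed.

(** This is the finiteness of Zp / pZp. A rational close to x has its denominator
    prime to p, so the denominator can be inverted modulo p. *)
Lemma padic_digit (x : Qp p_pr) : padic_abs x <= 1 ->
  exists a : 'I_p, padic_abs (x - (a : nat)%:R) <= p%:R^-1.
Proof.
move=> x1; have p0 : 0 < (p%:R^-1 : rat) by rewrite invr_gt0 ltr0n prime_gt0.
have [q xq] := Qp_dense x p0.
have q1 : padic_absq p q <= 1.
  rewrite -padic_abs_rat -[Qp_of_rat q](subrK x); apply: padic_absD_le => //.
  rewrite -padic_absN opprB; apply: le_trans (ltW xq) _.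
  by rewrite invf_le1 ?ler1n ?ltr0n prime_gt0.
have cop := padic_absq_le1_denq q1.
have d0 := denq_neq0 q.
have /coprimezP[[u v] /= uv] : coprimez (denq q) p%:Z by rewrite coprimezE coprime_sym.
(* By Bezout, u inverts the denominator of q modulo p. *)
pose a := (numq q * u %% p%:Z)%Z.
have a0 : 0 <= a by rewrite modz_ge0// -lt0n prime_gt0.
have ap : a < p%:Z by rewrite ltz_pmod// ltz_nat prime_gt0.
have ap' : (`|a|%N < p)%N by rewrite -ltz_nat gez0_abs.
exists (Ordinal ap') => /=.
have -> : x - `|a|%N%:R = (x - Qp_of_rat q) + (Qp_of_rat (q - a%:~R)).
  rewrite rmorphB /= addrA subrK; congr (_ - _).
  by rewrite -[in RHS](gez0_abs a0) rmorph_int -pmulrn.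
apply: padic_absD_le; first exact: ltW.
rewrite padic_abs_rat.
have [e ae] : exists e, a = numq q * u - e * p%:Z.
  exists (numq q * u %/ p%:Z)%Z; rewrite /a {2}(divz_eq (numq q * u) p%:Z).
  by rewrite addrC addKr.
have [->|nz] := eqVneq (q - a%:~R) 0; first by rewrite padic_absq0 ltW.
pose z := numq q * v + e * denq q.
have zE : q - a%:~R = (z * p%:Z)%:~R / (denq q)%:~R.
  have dq : (denq q)%:~R != 0 :> rat by rewrite intr_eq0.
  rewrite -{1}[q]divq_num_den -[a%:~R](mulfK dq) -mulrBl -rmorphM -rmorphB; congr (_%:~R / _).
  have -> : numq q - a * denq q = numq q * (u * denq q + v * p%:Z) - a * denq q.
    by rewrite uv mulr1.
  rewrite ae /z; ring.
have z0 : z * p%:Z != 0.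
  by apply: contraNneq nz; rewrite zE => ->; rewrite mul0r.
rewrite zE padic_absq_frac//.
rewrite -[X in _ <= X]exprN1 ler_eXz2l ?ltr1n ?prime_gt1//.
move: cop; rewrite prime_coprime// => /negbTE cop; rewrite lognE cop.
rewrite !andbF sub0r lerN2 lez_nat -pfactor_dvdn ?absz_gt0// expn1.
by rewrite abszM dvdn_mull.
Qed.

(** The bound on x stands below the existential quantifier, so that choice provides
    a total function that can be iterated. *)
Lemma padic_digit_step (x : Qp p_pr) : exists ay : 'I_p * Qp p_pr,
  padic_abs x <= 1 -> x = (ay.1 : nat)%:R + p%:R * ay.2 /\ padic_abs ay.2 <= 1.
Proof.
have [x1|x1] := boolP (padic_abs x <= 1); last by exists (Ordinal (prime_gt0 p_pr), 0).
have [a xa] := padic_digit x1.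
exists (a, (x - (a : nat)%:R) / p%:R) => _ /=; split.
  by rewrite mulrC divfK ?Qp_p_neq0// addrC subrK.
rewrite padic_absM padic_absV padic_abs_p invrK.
by rewrite -ler_pdivlMr ?ltr0n ?prime_gt0// mul1r.
Qed.

(** After n steps the remainder is p^n times an integer of Qp. *)
Lemma padic_expansion_int (x : Qp p_pr) : padic_abs x <= 1 ->
  exists a : nat -> nat, (forall n, (a n < p)%N) /\
    forall n, padic_abs (x - \sum_(j < n) (a j)%:R * p%:R ^+ j) <= p%:R ^- n.
Proof.
move=> x1; have [f fP] := choice padic_digit_step.
pose y n := iter n (fun z => (f z).2) x.
have y1 n : padic_abs (y n) <= 1.
  by elim: n => [//|n IH]; have [_] := fP _ IH.
exists (fun n => (f (y n)).1 : nat); split=> [n|n]; first exact: ltn_ord.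
have -> : x - \sum_(j < n) ((f (y j)).1 : nat)%:R * p%:R ^+ j = p%:R ^+ n * y n.
  elim: n => [|n IH]; first by rewrite big_ord0 subr0 mul1r.
  rewrite big_ord_recr /= opprD addrA IH {1}(fP _ (y1 n)).1 exprSr /=; ring.
rewrite padic_absM (padic_abs_pX n) -invr_expz.
by rewrite ger_pMr ?invr_gt0 ?exprz_gt0 ?ltr0n ?prime_gt0.
Qed.

End Qp_rationals.

(** * Digit expansions and the fractional part *)

(** Vanishing below - M makes the support finite; reindexing by j = k + M turns the
    sum into an ordinary one. *)
Lemma fsbig_int_lt (V : nmodType) (F : int -> V) (M n : nat) :
  (forall k, k < - M%:Z -> F k = 0) ->
  \sum_(k \in [set k : int | k < n%:Z]) F k = \sum_(j < M + n) F (j%:Z - M%:Z).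
Proof.
move=> F0; pose r := [seq j%:Z - M%:Z | j <- iota 0 (M + n)].
rewrite -(@fsbig_widen _ _ _ _ [set` r]).
- rewrite -fsbig_seq; first by rewrite big_map -[in iota _ _](subn0 (M + n)%N) big_mkord.
  rewrite map_inj_uniq ?iota_uniq// => i j /addIr; exact: (can_inj absz_nat).
- move=> k /= /mapP[j + ->]; rewrite mem_iota /= add0n => jn; rewrite ltrBlDr -PoszD ltz_nat addnC//.
- move=> k /= [kn] kr; apply: F0; rewrite ltNge; apply/negP => Mk; apply: kr; apply/mapP.
  have Mk0 : 0 <= k + M%:Z by rewrite -lerBlDr sub0r.
  exists (absz (k + M%:Z)); last by rewrite gez0_abs// addrK.
  by rewrite mem_iota /= add0n -ltz_nat gez0_abs// PoszD addrC ltrD2l.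
Qed.

Section Qp_frac.
Variables (p : nat) (p_pr : prime p).
Local Notation iotaQ := (Qp_of_rat p_pr).

Let p0 : (0 : rat) < p%:R. Proof. by rewrite ltr0n prime_gt0. Qed.

Lemma padic_abs_sum_le (n : nat) (F : 'I_n -> Qp p_pr) (c : rat) : 0 <= c ->
  (forall i, padic_abs (F i) <= c) -> padic_abs (\sum_(i < n) F i) <= c.
Proof.
by move=> c0 Fc; elim/big_ind : _ => // [|x y]; rewrite ?padic_abs0//; exact: padic_absD_le.
Qed.

Lemma padic_expNn_small (e : rat) : 0 < e -> exists n : nat, (p%:R : rat) ^- n < e.
Proof.
move=> e0; exists (Num.bound e^-1); rewrite invf_plt ?posrE ?exprn_gt0//.
apply: lt_trans (archi_boundP _) _; first by rewrite invr_ge0 ltW.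
by rewrite -natrX ltr_nat ltn_expl// prime_gt1.
Qed.

(** A power of p brings x into Zp; the digits of the product are then shifted back. *)
Lemma padic_expansion_ex (x : Qp p_pr) : exists a, is_padic_expansion x a.
Proof.
have [M xM] : exists M : nat, padic_abs (p%:R ^+ M * x) <= 1.
  have [->|/padic_abs_val[k xk]] := eqVneq x 0; first by exists 0%N; rewrite mulr0 padic_abs0.
  exists `|k|%N; rewrite padic_absM (padic_abs_pX p_pr `|k|%N) xk -expfzDr ?gt_eqF//.
  by rewrite -[X in _ <= X](expr0z p%:R) ler_eXz2l ?ltr1n ?prime_gt1// addrC subr_le0 abszE ler_norm.
have [a' [a'p xa']] := padic_expansion_int xM.
pose a (k : int) := if 0 <= k + M%:Z then a' (absz (k + M%:Z)) else 0%N.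
exists a; split.
- by move=> k; rewrite /a; case: ifP => // _; rewrite prime_gt0.
- exists (- M%:Z) => k kM; rewrite /a ifF//; apply/negbTE; rewrite -ltNge.
  by rewrite -ltrBrDr sub0r.
- have aE n : \sum_(k \in [set k : int | k < n%:Z]) (a k)%:R * (p%:R : Qp p_pr) ^ k =
     (p%:R ^- M) * \sum_(j < M + n) (a' j)%:R * p%:R ^+ j.
    rewrite (@fsbig_int_lt _ _ M).
      rewrite mulr_sumr; apply: eq_bigr => j _.
      by rewrite /a subrK /= expfzDr ?Qp_p_neq0// -invr_expz -!exprnP [LHS]mulrA [RHS]mulrC.
    move=> k kM; rewrite /a ifF ?mul0r//; apply/negbTE; rewrite -ltNge.
    by rewrite -ltrBrDr sub0r.
  under eq_fun do rewrite aE.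
  apply/cvg_ballP => e e0; have [N Ne] := padic_expNn_small e0.
  exists N => // n /= Nn; rewrite /ball /= /Qp_dist.
  have -> : x = p%:R ^- M * (p%:R ^+ M * x).
    by rewrite mulKf// expf_neq0// Qp_p_neq0.
  rewrite -mulrBr padic_absM padic_absV (padic_abs_pX p_pr M).
  apply: le_lt_trans (ler_wpM2l _ (xa' _)) _.
    by rewrite invr_ge0 exprz_ge0// ltW.
  rewrite -invr_expz invrK exprD invfM mulVKf ?expf_neq0 ?gt_eqF//.
  apply: le_lt_trans Ne; rewrite lef_pV2 ?posrE ?exprn_gt0//.
  by rewrite ler_eXn2l ?ltr1n ?prime_gt1.
Qed.

(** Any expansion has these two properties, and by [padic_int_rat] they determine the
    fractional part modulo 1, hence the character. *)
Lemma padic_frac_spec (x : Qp p_pr) :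
  (exists M : nat, padic_frac x * p%:R ^+ M \is a Num.int) /\
  padic_abs (x - iotaQ (padic_frac x)) <= 1.
Proof.
have : is_padic_expansion x (padic_digits x).
  by rewrite /padic_digits; case: xgetP => [? -> //|]; have [a xa] := padic_expansion_ex x => /(_ a xa).
rewrite /padic_frac; set a := padic_digits x => -[_ [m am] ax].
pose M := `|m|%N.
have aM (k : int) : k < - M%:Z -> a k = 0%N.
  move=> kM; apply: am; apply: lt_le_trans kM _.
  by rewrite /M abszE lerNl ler_normr lexx orbT.
rewrite (@fsbig_int_lt _ _ M 0); last by move=> k kM; rewrite aM// mul0r.
rewrite addn0; split.
  exists M; rewrite mulr_suml rpred_sum// => j _.
  rewrite -mulrA expfzDr ?gt_eqF// -invr_expz -mulrA mulVf ?mulr1 ?expf_neq0 ?gt_eqF//.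
  by rewrite rpredM ?rpred_nat// -exprnP rpredX ?rpred_nat.
have -> : iotaQ (\sum_(i < M) (a (i%:Z - M%:Z))%:R * p%:R ^ (i%:Z - M%:Z)) =
   \sum_(i < M) (a (i%:Z - M%:Z))%:R * p%:R ^ (i%:Z - M%:Z).
  by rewrite rmorph_sum; apply: eq_bigr => i _; rewrite rmorphM fmorphXz !rmorph_nat.
move/cvg_ballP : ax => /(_ 1 ltr01)[N _ /(_ N (leqnn N))].
rewrite (@fsbig_int_lt _ _ M N); last by move=> k kM; rewrite aM// mul0r.
rewrite big_split_ord /ball /= /Qp_dist opprD addrA.
set S := \sum_(i < M) _; set T := \sum_(i < N) _ => /ltW xS.
rewrite -(subrK T (x - S)); apply: padic_absD_le => //.
apply: padic_abs_sum_le => // i.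
rewrite padic_absM -[X in _ <= X]mulr1; apply: ler_pM; rewrite ?padic_abs_ge0 ?padic_abs_nat_le1//.
rewrite padic_abs_pX PoszD addrAC subrr add0r -invr_expz.
by rewrite invf_le1 ?exprz_gt0// -exprnP exprn_ege1// ler1n prime_gt0.
Qed.

(** Z[1/p] and Zp meet in Z: the denominator divides a power of p and is prime to p. *)
Lemma padic_int_rat (q : rat) (M : nat) : q * p%:R ^+ M \is a Num.int ->
  padic_abs (iotaQ q) <= 1 -> q \is a Num.int.
Proof.
move=> /intrP[n qn]; rewrite padic_abs_rat => /(padic_absq_le1_denq p_pr) cop.
rewrite Qint_def.
have E : (numq q * (p ^ M)%N%:Z = n * denq q)%R.
  apply/eqP; rewrite -(eqr_int rat) !rmorphM /= -qn -pmulrn natrX.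
  have := divq_num_den q => /(canRL (mulfVK _)) -> //; last by rewrite intr_eq0 denq_neq0.
  by rewrite mulrAC.
have : (`|denq q| %| `|numq q| * p ^ M)%N.
  by move/(congr1 absz): E; rewrite !abszM /= => ->; rewrite dvdn_mull.
rewrite Gauss_dvdr; last by rewrite coprime_sym coprime_num_den.
have : coprime `|denq q| (p ^ M) by rewrite coprime_sym coprimeXl.
rewrite /coprime => /eqP dp /gcdn_idPl; rewrite dp => d1.
rewrite -[denq q]gez0_abs ?denq_ge0//; apply/eqP. exact: (congr1 Posz (esym d1)).
Qed.

Lemma padic_frac_int (x : Qp p_pr) : padic_abs x <= 1 -> padic_frac x \is a Num.int.
Proof.
move=> x1; have [[M xM] xf] := padic_frac_spec x; apply: padic_int_rat xM _.
rewrite -[iotaQ _](subKr x); exact: padic_absB_le.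
Qed.

Lemma padic_frac_notint (x : Qp p_pr) : 1 < padic_abs x -> padic_frac x \isn't a Num.int.
Proof.
move=> x1; have [_ xf] := padic_frac_spec x; apply/negP => /intrP[n xn].
move: x1; rewrite ltNge -(subrK (iotaQ (padic_frac x)) x) => /negP; apply.
apply: padic_absD_le => //.
have E (m : nat) : padic_abs (iotaQ m%:R) <= 1 by rewrite rmorph_nat padic_abs_nat_le1.
rewrite xn; case: n {xn} => n; first by rewrite -pmulrn.
rewrite NegzE mulrNz rmorphN padic_absN -pmulrn; exact: E.
Qed.

(** The difference lies in Z[1/p], and also in Zp because x + y cancels against its two
    summands. *)
Lemma padic_fracD (x y : Qp p_pr) :
  padic_frac (x + y) - (padic_frac x + padic_frac y) \is a Num.int.
Proof.
have [[M xM] xf] := padic_frac_spec x; have [[N yN] yf] := padic_frac_spec y.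
have [[L zL] zf] := padic_frac_spec (x + y).
have up q (A B : nat) : q * p%:R ^+ A \is a Num.int -> q * p%:R ^+ (A + B) \is a Num.int.
  by move=> qA; rewrite exprD mulrA rpredM// rpredX// rpred_nat.
apply: (@padic_int_rat _ (M + N + L)%N).
  rewrite mulrBl mulrDl rpredB ?rpredD//.
  - by rewrite addnC up.
  - by rewrite -addnA up.
  - by rewrite [(M + N)%N]addnC -addnA up.
rewrite rmorphB rmorphD /=.
set X := iotaQ _ in xf *; set Y := iotaQ _ in yf *; set Z := iotaQ _ in zf *.
have -> : Z - (X + Y) = ((x - X) + (y - Y)) - (x + y - Z) by ring.
by apply: padic_absB_le => //; apply: padic_absD_le.
Qed.

End Qp_frac.

(** * The additive character *)

Section Qp_character.
Variables (R : realType) (p : nat) (p_pr : prime p).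

Definition padic_angle (x : Qp p_pr) : R := 2 * pi * ratr (padic_frac x).

Lemma cosD2pi_int (t s : R) : s \is a Num.int -> cos (t + 2 * pi * s) = cos t.
Proof.
have H (u : R) (n : nat) : cos (u + 2 * pi * n%:R) = cos u.
  have -> : 2 * pi * n%:R = (@pi R) *+ 2 *+ n
    by rewrite -mulrnA -[RHS]mulr_natl natrM; move: (@pi R) => c; ring.
  exact: (periodicn (@cosD2pi R)).
move=> /intrP[[n|n] ->]; first by rewrite -pmulrn H.
by rewrite NegzE mulrNz -pmulrn -[in RHS](subrK (2 * pi * n.+1%:R) t) H mulrN.
Qed.

Lemma sinD2pi_int (t s : R) : s \is a Num.int -> sin (t + 2 * pi * s) = sin t.
Proof.
by move=> s_int; rewrite -!cosBpihalf addrAC cosD2pi_int.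
Qed.

Lemma ratr_Qint (q : rat) : q \is a Num.int -> ratr q \is a @Num.int R.
Proof. by move=> /intrP[n ->]; rewrite ratr_int rpred_int. Qed.

Lemma padic_angleD (x y : Qp p_pr) : exists2 s : R, s \is a Num.int &
  padic_angle (x + y) = padic_angle x + padic_angle y + 2 * pi * s.
Proof.
exists (ratr (padic_frac (x + y) - (padic_frac x + padic_frac y))).
  by apply: ratr_Qint; exact: padic_fracD.
by rewrite /padic_angle !(rmorphB, rmorphD) /=; move: (@pi R) => c; ring.
Qed.

Lemma cos_padic_angleD (x y : Qp p_pr) :
  cos (padic_angle (x + y)) = cos (padic_angle x + padic_angle y).
Proof. by have [s s_int ->] := padic_angleD x y; rewrite cosD2pi_int. Qed.

Lemma sin_padic_angleD (x y : Qp p_pr) :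
  sin (padic_angle (x + y)) = sin (padic_angle x + padic_angle y).
Proof. by have [s s_int ->] := padic_angleD x y; rewrite sinD2pi_int. Qed.

Lemma cos_padic_angle1 (x : Qp p_pr) : padic_abs x <= 1 -> cos (padic_angle x) = 1.
Proof.
by move=> /padic_frac_int /ratr_Qint h; rewrite -[padic_angle x]add0r cosD2pi_int ?cos0.
Qed.

Lemma sin_padic_angle0 (x : Qp p_pr) : padic_abs x <= 1 -> sin (padic_angle x) = 0.
Proof.
by move=> /padic_frac_int /ratr_Qint h; rewrite -[padic_angle x]add0r sinD2pi_int ?sin0.
Qed.

(** Up to a multiple of 2 pi, the angle lies strictly between 0 and 2 pi. Half of it
    then has a positive sine. *)
Lemma cos_padic_angle_neq1 (x : Qp p_pr) : 1 < padic_abs x -> cos (padic_angle x) != 1.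
Proof.
move=> /padic_frac_notint; rewrite /padic_angle; set q := padic_frac x => q_nint.
pose s : R := ratr (q - (Num.floor q)%:~R).
have q0 : 0 < q - (Num.floor q)%:~R.
  by rewrite subr_gt0 lt_neqAle floor_le andbT; apply: contraNneq q_nint => <-; rewrite rpred_int.
have q1 : q - (Num.floor q)%:~R < 1 by rewrite ltrBlDl -intrD1 floorD1_gt.
have s0 : 0 < s by rewrite ltr0q.
have s1 : s < 1 by rewrite -(rmorph1 ratr) ltr_rat.
have -> : 2 * pi * ratr q = (pi * s) *+ 2 + 2 * pi * ratr (Num.floor q)%:~R :> R.
  by rewrite /s rmorphB /= -mulr_natl; move: (@pi R) => c; ring.
rewrite cosD2pi_int; last by apply: ratr_Qint; rewrite rpred_int.
rewrite cos_mulr2n cos2sin2 lt_eqF//.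
have : 0 < sin (pi * s).
  by apply: sin_gt0_pi; rewrite mulr_gt0 ?pi_gt0//= gtr_pMr ?pi_gt0.
by move=> h; have := exprn_gt0 2 h => {}h; rewrite mulr2n; lra.
Qed.

End Qp_character.

(** * Balls and Borel sets of Qp^d *)

Section balls.
Variables (p : nat) (p_pr : prime p) (d : nat).
Implicit Types (x y a : Qpd p_pr d) (k l m : int).

Let p0 : (0 : rat) < p%:R. Proof. by rewrite ltr0n prime_gt0. Qed.
Let p1 : (1 : rat) < p%:R. Proof. by rewrite ltr1n prime_gt1. Qed.

Definition padic_ball k a : set (Qpd p_pr d) :=
  [set x | forall j, padic_abs (x 0 j - a 0 j) <= p%:R ^ k].

Lemma padic_ball_center k a : padic_ball k a a.
Proof. by move=> j; rewrite subrr padic_abs0 exprz_ge0// ltW. Qed.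

Lemma padic_ball_le k l a : k <= l -> padic_ball k a `<=` padic_ball l a.
Proof. by move=> kl x xa j; apply: le_trans (xa j) _; rewrite ler_weXz2l// ltW. Qed.

(** Ultrametric inequality: every point of a ball is a centre. *)
Lemma padic_ball_eq k a x : padic_ball k a x -> padic_ball k x = padic_ball k a.
Proof.
move=> ax; apply/seteqP; split => y xy j.
  by rewrite -(subrK (x 0 j) (y 0 j)) -addrA; apply: padic_absD_le.
rewrite -(subrK (a 0 j) (y 0 j)) -addrA; apply: padic_absD_le => //.
by rewrite -padic_absN opprB.
Qed.

Lemma padic_ball_disjoint k l a b : k <= l ->
  padic_ball k a `<=` padic_ball l b \/ padic_ball k a `&` padic_ball l b = set0.
Proof.
move=> kl; have [|] := pselect (exists x, (padic_ball k a `&` padic_ball l b) x).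
  move=> [x [ax bx]]; left; rewrite -(padic_ball_eq ax) -(padic_ball_eq bx).
  exact: padic_ball_le.
by move=> /forallNP h; right; apply/seteqP; split.
Qed.

Lemma padic_expz_small (e : rat) : 0 < e -> exists k : int, p%:R ^ k < e.
Proof. by move=> /(padic_expNn_small p_pr)[n ne]; exists (- n%:Z); rewrite -invr_expz. Qed.

Lemma padic_ball_nbhs (U : set 'rV[Qp p_pr]_d) a : open U -> U a ->
  exists k, padic_ball k a `<=` U.
Proof.
rewrite openE => + Ua => /(_ _ Ua) /nbhs_ballP[e e0 eU].
have [k ke] := padic_expz_small e0; exists k => x ax; apply: eU; split => // i j.
rewrite ord1 /ball /= Qp_distC; exact: le_lt_trans (ax j) ke.
Qed.

Lemma open_padic_ballP (U : set 'rV[Qp p_pr]_d) :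
  (forall x, U x -> exists k, padic_ball k x `<=` U) -> open U.
Proof.
move=> h; rewrite openE => x /h[k kU]; apply/nbhs_ballP.
have e0 : 0 < p%:R ^ k :> rat by rewrite exprz_gt0.
exists (p%:R ^ k) => // y [_ xy]; apply: kU => j; apply: ltW.
by have := xy 0 j; rewrite /ball /= Qp_distC.
Qed.

Lemma open_measurable_Qpd (U : set 'rV[Qp p_pr]_d) : open U ->
  measurable (U : set (Qpd p_pr d)).
Proof. exact: sub_sigma_algebra. Qed.

Lemma measurable_padic_ball k a : measurable (padic_ball k a).
Proof.
apply: open_measurable_Qpd; apply: open_padic_ballP => x ax; exists k.
by rewrite (padic_ball_eq ax).
Qed.

Lemma padic_ball_shift k a b :
  [set a + x | x in padic_ball k b] = padic_ball k (a + b).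
Proof.
apply/seteqP; split => [_ [y yb <-] j|y yab].
  by rewrite !mxE opprD addrACA subrr add0r.
exists (y - a); last by rewrite addrC subrK.
by move=> j; have := yab j; rewrite !mxE opprD addrA.
Qed.

Definition rat_row (q : 'rV[rat]_d) : Qpd p_pr d := map_mx (Qp_of_rat p_pr) q.

Lemma rat_row_dense k x : exists q, padic_ball k (rat_row q) x.
Proof.
have pk : 0 < (p%:R : rat) ^ k by rewrite exprz_gt0.
have /choice[q xq] j := Qp_dense (x 0 j) pk.
by exists (\row_j q j) => j; rewrite !mxE ltW.
Qed.

(** A pi-system that generates the Borel sets. The bound on the radius keeps the
    measure of its members finite and makes coset counting below radius p^m
    sufficient. *)
Definition balls_le m : set (set (Qpd p_pr d)) :=
  [set A | A = set0 \/ exists l a, l <= m /\ A = padic_ball l a].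

Lemma balls_le_measurable m : balls_le m `<=` measurable.
Proof. by move=> _ [->//|[l [a [_ ->]]]]; exact: measurable_padic_ball. Qed.

Lemma balls_le_setI m : setI_closed (balls_le m).
Proof.
move=> A B [->|[k [a [km ->]]]]; first by rewrite set0I; left.
move=> [->|[l [b [lm ->]]]]; first by rewrite setI0; left.
have [kl|/ltW lk] := leP k l.
  have [/setIidl ->|->] := padic_ball_disjoint a b kl; last by left.
  by right; exists k, a.
rewrite setIC; have [/setIidl ->|->] := padic_ball_disjoint b a lk; last by left.
by right; exists l, b.
Qed.

(** Countably many balls suffice, those with a rational centre and radius p^(m - j). *)
Lemma open_balls_le m (U : set 'rV[Qp p_pr]_d) : open U -> <<s balls_le m >> U.
Proof.
move=> oU.
pose F n : set (Qpd p_pr d) := if unpickle n is Some (q, j) then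
  if `[< padic_ball (m - j%:Z) (rat_row q) `<=` U >]
  then padic_ball (m - j%:Z) (rat_row q) else set0 else set0.
have -> : U = \bigcup_n F n.
  apply/seteqP; split => [x Ux|x [n _]]; last first.
    by rewrite /F; case: unpickle => [[q j]|//]; case: asboolP => // h /h.
  have [k kU] := padic_ball_nbhs oU Ux.
  pose j := `|m - k|%N.
  have jk : m - j%:Z <= k by rewrite lerBlDl -lerBlDr abszE ler_norm.
  have [q xq] := rat_row_dense (m - j%:Z) x.
  exists (pickle (q, j)) => //; rewrite /F pickleK asboolT//.
  by rewrite -(padic_ball_eq xq) => y /(padic_ball_le jk)/kU.
apply: (@bigcupT_measurable _ (g_sigma_algebraType (balls_le m))) => n.
apply: sub_sigma_algebra; rewrite /F; case: unpickle => [[q j]|]; last by left.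
case: asboolP => _; last by left.
by right; exists (m - j%:Z), (rat_row q); split => //; rewrite gerBl.
Qed.

Lemma measurable_balls_le m (A : set (Qpd p_pr d)) : measurable A -> <<s balls_le m >> A.
Proof.
apply: smallest_sub; first exact: smallest_sigma_algebra.
by move=> U; exact: open_balls_le.
Qed.

End balls.

(** * Haar measure of balls *)

Section haar.
Variables (R : realType) (p : nat) (p_pr : prime p) (d : nat).

Let p0 : (0 : rat) < p%:R. Proof. by rewrite ltr0n prime_gt0. Qed.
Let p1 : (1 : rat) < p%:R. Proof. by rewrite ltr1n prime_gt1. Qed.

(** The vectors with one digit each, in position - (k + 1), represent the cosets of
    the smaller ball in the larger one: every coset is reached by [padic_digit], and
    none twice because two distinct digits differ by less than p. *)
Lemma padic_ball_split (k : int) : exists F : {ffun 'I_d -> 'I_p} -> Qpd p_pr d,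
  [/\ forall f, padic_ball (k + 1) 0 (F f),
  padic_ball (k + 1) 0 = \bigcup_(f in setT) padic_ball k (F f) &
  trivIset setT (fun f => padic_ball k (F f))].
Proof.
pose F (f : {ffun 'I_d -> 'I_p}) : Qpd p_pr d :=
  \row_j ((f j : nat)%:R * p%:R ^ (- (k + 1))).
have F0 f : padic_ball (k + 1) 0 (F f).
  move=> j; rewrite !mxE subr0 padic_absM padic_abs_pX opprK ler_piMl ?exprz_ge0 ?(ltW p0)//.
  exact: padic_abs_nat_le1.
exists F; split => //.
  apply/seteqP; split => [x xk|x [f _ xf]]; last first.
    rewrite -(padic_ball_eq (F0 f)); apply: padic_ball_le xf.
    by rewrite lerDl.
  have /choice[f xf] (j : 'I_d) : exists a : 'I_p,
      padic_abs (x 0 j - (a : nat)%:R * p%:R ^ (- (k + 1))) <= p%:R ^ k.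
    have [|a xa] := @padic_digit p p_pr (x 0 j * p%:R ^ (k + 1)).
      rewrite padic_absM padic_abs_pX -invr_expz ler_pdivrMr ?exprz_gt0// mul1r.
      by have := xk j; rewrite mxE subr0.
    exists a; rewrite -[x 0 j](mulfK (expfz_neq0 (k + 1) (Qp_p_neq0 p_pr))).
    rewrite invr_expz -mulrBl padic_absM padic_abs_pX opprK.
    have -> : p%:R ^ k = p%:R^-1 * p%:R ^ (k + 1) :> rat.
      by rewrite addrC expfzDr ?gt_eqF// expr1z mulKf// gt_eqF.
    by rewrite ler_pM2r ?exprz_gt0.
  by exists [ffun j => f j] => // j; rewrite !mxE ffunE.
move=> f g _ _ [x [xf xg]]; apply/ffunP => j; apply: val_inj => /=.
have := padic_absB_le (xg j) (xf j).
rewrite !mxE opprB addrCA addrAC subrr add0r.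
rewrite -mulrBl padic_absM padic_abs_pX opprK [k + 1]addrC expfzDr ?gt_eqF// expr1z.
rewrite -[X in _ <= X]mul1r mulrA ler_pM2r ?exprz_gt0// -ler_pdivlMr// mul1r.
wlog fg : f g {xf xg} / (f j <= g j)%N => [H|].
  case/orP: (leq_total (f j) (g j)) => h; first exact: H.
  by rewrite -padic_absN opprB => /H ->.
rewrite -padic_absN opprB -natrB// -(rmorph_nat (Qp_of_rat p_pr)) padic_abs_rat.
move=> h; apply/eqP; rewrite eqn_leq fg /= -subn_eq0; apply/negPn/negP => nz.
move: h; have := @padic_absq_frac p (g j - f j)%N%:Z 1.
rewrite divr1 -pmulrn => -> //.
rewrite -[X in _ <= X]exprN1 ler_eXz2l// /= logn1 sub0r lerN2 lez_nat.
rewrite -pfactor_dvdn ?lt0n// expn1 => /dvdn_leq; rewrite lt0n nz => /(_ isT).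
by rewrite leqNgt (leq_ltn_trans (leq_subr _ _) (ltn_ord (g j))).
Qed.

Variable nu : {measure set (Qpd p_pr d) -> \bar R}.

(** The condition bears on balls, the sets that coset counting uses, so that an image
    measure can be tested on explicit sets. *)
Definition ball_invariant (m : int) := forall a l, (l <= m) -> padic_ball m 0 a ->
  nu (padic_ball l a) = nu (padic_ball l 0).

Lemma ball_invariant_step (m k : int) : ball_invariant m -> k + 1 <= m ->
  nu (padic_ball (k + 1) 0) = ((p ^ d)%:R%:E * nu (padic_ball k 0%R))%E.
Proof.
move=> inv km; have [F [F0 -> tF]] := padic_ball_split k.
rewrite measure_fin_bigcup//; [|exact: finite_finset|by move=> f _; exact: measurable_padic_ball].
rewrite (eq_fsbigr (fun=> nu (padic_ball k 0))); last first.
  move=> f _; apply: inv; first by apply: le_trans km; rewrite lerDl.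
  by apply: padic_ball_le km _ _.
have -> : [set: {ffun 'I_d -> 'I_p}] = [set` enum {ffun 'I_d -> 'I_p}].
  by apply/seteqP; split => f //= _; rewrite mem_enum.
rewrite -fsbig_seq ?enum_uniq// big_enum sumr_const card_ffun !card_ord.
by rewrite mule_natl.
Qed.

Lemma ball_invariant_descend (m : int) (n : nat) : ball_invariant m ->
  nu (padic_ball m 0) = (((p ^ d) ^ n)%:R%:E * nu (padic_ball (m - n%:Z) 0%R))%E.
Proof.
move=> inv; elim: n => [|n IH]; first by rewrite subr0 expn0 mul1e.
rewrite IH; have -> : m - n%:Z = (m - n.+1%:Z) + 1 by rewrite intS; ring.
rewrite (@ball_invariant_step m) ?muleA -?EFinM -?natrM -?expnSr// -addrA gerDl.
by rewrite intS opprD addrAC addNr add0r oppr_le0.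
Qed.

End haar.

Section haar_balls.
Variables (R : realType) (p : nat) (p_pr : prime p) (d : nat).
Variable mu : {measure set (Qpd p_pr d) -> \bar R}.
Hypothesis hmu : is_normalized_haar mu.

Lemma haar_shift (k : int) a : mu (padic_ball k a) = mu (padic_ball k 0).
Proof.
rewrite -[RHS](hmu.2 a); last exact: measurable_padic_ball.
by rewrite padic_ball_shift addr0.
Qed.

Lemma haar_ball_invariant m : ball_invariant mu m.
Proof. by move=> a l _ _; exact: haar_shift. Qed.

Lemma haar_ball (k : int) a : mu (padic_ball k a) = ((p ^ d)%:R ^ k)%:E.
Proof.
have q0 : (p ^ d)%:R != 0 :> R by rewrite pnatr_eq0 expn_eq0 negb_and -lt0n prime_gt0.
rewrite haar_shift.
have mu0 : mu (padic_ball 0 0) = 1%E.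
  rewrite -hmu.1; congr (mu _); apply/seteqP.
  by split => x h j; have := h j; rewrite mxE subr0 expr0z.
case: k => n.
  by rewrite (ball_invariant_descend n (@haar_ball_invariant _)) subrr mu0 mule1 natrX.
(* Below radius 1 the count is read from the unit ball downwards. *)
have := ball_invariant_descend n.+1 (@haar_ball_invariant 0).
rewrite mu0 sub0r -NegzE => h.
have qn : ((p ^ d) ^ n.+1)%:R != 0 :> R by rewrite natrX expf_neq0.
have := congr1 (mule (((p ^ d) ^ n.+1)%:R^-1)%:E) h.
by rewrite mule1 muleA -EFinM mulVf// mul1e natrX NegzE -invr_expz => <-.
Qed.

End haar_balls.

(** * Uniqueness of invariant measures on a ball *)

Section uniqueness.
Variables (R : realType) (p : nat) (p_pr : prime p) (d : nat).
Variables (m : int) (nu1 nu2 : {measure set (Qpd p_pr d) -> \bar R}).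
Hypothesis inv1 : ball_invariant nu1 m.
Hypothesis inv2 : ball_invariant nu2 m.
Hypothesis supp1 : forall A, measurable A -> A `&` padic_ball m 0 = set0 -> nu1 A = 0%E.
Hypothesis supp2 : forall A, measurable A -> A `&` padic_ball m 0 = set0 -> nu2 A = 0%E.
Hypothesis nu12 : nu1 (padic_ball m 0) = nu2 (padic_ball m 0).
Hypothesis nuoo : (nu1 (padic_ball m 0%R) < +oo)%E.

(** A ball of radius at most p^m either lies in the large one, where coset counting
    fixes its share of the total mass, or misses it and is null. So both measures
    agree on a generating pi-system. *)
Lemma ball_invariant_unique A : measurable A -> nu1 A = nu2 A.
Proof.
move=> mA.
pose g n : set (Qpd p_pr d) := padic_ball m (rat_row p_pr (odflt 0 (unpickle n))).
have nuG B : balls_le m B -> nu1 B = nu2 B.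
  move=> [->|[l [a [lm ->]]]]; first by rewrite !measure0.
  have [h|h] := padic_ball_disjoint a 0 lm; last first.
    by rewrite supp1 ?supp2//; exact: measurable_padic_ball.
  have a0 := h _ (padic_ball_center l a).
  rewrite inv1// inv2//.
  have lE : l = m - `|m - l|%N%:Z by rewrite gez0_abs ?subr_ge0// subKr.
  have := ball_invariant_descend `|m - l| inv1; rewrite nu12 (ball_invariant_descend `|m - l| inv2) -lE.
  have q0 : (((p ^ d) ^ `|m - l|)%:R != 0 :> R).
    by rewrite pnatr_eq0 !expn_eq0 !negb_and -lt0n prime_gt0.
  move=> /(congr1 (mule (((p ^ d) ^ `|m - l|)%:R^-1)%:E)).
  by rewrite !muleA -!EFinM !mulVf// !mul1e.
apply: (g_sigma_algebra_measure_unique (balls_le m) (@balls_le_measurable _ _ _ _) g) => //.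
- by move=> n; right; exists m, (rat_row p_pr (odflt 0 (unpickle n))).
- apply/seteqP; split => // x _; have [q xq] := rat_row_dense m x.
  by exists (pickle q) => //; rewrite /g pickleK.
- exact: balls_le_setI.
- move=> n; rewrite /g; set a := rat_row _ _.
  have [h|h] := padic_ball_disjoint a 0 (lexx m); last first.
    by rewrite supp1//; exact: measurable_padic_ball.
  by rewrite inv1//; exact: h (padic_ball_center _ _).
- exact: measurable_balls_le.
Qed.

End uniqueness.

(** * The image of Haar measure under a coordinate *)

Section coordinate.
Variables (R : realType) (p : nat) (p_pr : prime p) (d : nat) (i : 'I_d).

Definition coord_row (x : 'rV[Qp p_pr]_d) : 'rV[Qp p_pr]_1 := const_mx (x 0 i).

Lemma coord_row_ball k (a x : Qpd p_pr d) : padic_ball k a x -> padic_ball k (coord_row a) (coord_row x).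
Proof. by move=> ax j; rewrite !mxE. Qed.

(** The coordinate does not increase distances. *)
Lemma continuous_coord_row : continuous coord_row.
Proof.
apply/continuousP => U oU; apply: open_padic_ballP => x Ux.
have [k kU] := padic_ball_nbhs oU Ux.
by exists k => y /coord_row_ball /kU.
Qed.

Lemma measurable_coord_row : measurable_fun setT (coord_row : Qpd p_pr d -> Qpd p_pr 1).
Proof.
apply: (measurability (@open 'rV[Qp p_pr]_1 : set (set (Qpd p_pr 1)))) => //.
move=> _ [U oU <-]; rewrite setTI; apply: open_measurable_Qpd.
by apply: open_comp => // x _; exact: continuous_coord_row.
Qed.

(** As functions of B, both sides are probability measures carried by the ball of radius p^k. The
    left one is invariant because a translation of the line lifts to a translation of
    the space by a constant vector, so uniqueness applies. *)
Lemma haar_coord (mu_d : {measure set (Qpd p_pr d) -> \bar R})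
    (mu_1 : {measure set (Qpd p_pr 1) -> \bar R}) (k : int) (B : set (Qpd p_pr 1)) :
  is_normalized_haar mu_d -> is_normalized_haar mu_1 -> measurable B ->
  (((p ^ d)%:R ^ (- k))%:E * mu_d (coord_row @^-1` B `&` padic_ball k 0%R) =
   ((p ^ 1)%:R ^ (- k))%:E * mu_1 (B `&` padic_ball k 0%R))%E.
Proof.
move=> hd h1 mB.
have q0 n : (0 : R) <= (p ^ n)%:R ^ (- k) by rewrite exprz_ge0.
have mball n : measurable (padic_ball k 0 : set (Qpd p_pr n)) by exact: measurable_padic_ball.
have [nu1 nu1E] : exists nu1 : {measure set (Qpd p_pr 1) -> \bar R}, forall A,
    nu1 A = (((p ^ d)%:R ^ (- k))%:E * mu_d (coord_row @^-1` A `&` padic_ball k 0%R))%E.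
  unshelve eexists (mscale (NngNum (q0 d)) (pushforward (mrestr mu_d (mball d))
    (coord_row : Qpd p_pr d -> Qpd p_pr 1)) : {measure set _ -> \bar R}) => //.
  exact: measurable_coord_row.
have [nu2 nu2E] : exists nu2 : {measure set (Qpd p_pr 1) -> \bar R}, forall A,
    nu2 A = (((p ^ 1)%:R ^ (- k))%:E * mu_1 (A `&` padic_ball k 0%R))%E.
  by exists (mscale (NngNum (q0 1%N)) (mrestr mu_1 (mball 1%N))).
have sub (x : Qpd p_pr d) : padic_ball k 0 x -> padic_ball k 0 (coord_row x).
  by move=> xk j; have := xk i; rewrite !mxE.
have pq n : (p ^ n)%:R != 0 :> R by rewrite pnatr_eq0 expn_eq0 negb_and -lt0n prime_gt0.
have ball1 : nu1 (padic_ball k 0) = 1%E.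
  rewrite nu1E setIidr//= haar_ball//.
  by rewrite -EFinM -expfzDr// addNr expr0z.
rewrite -nu1E -nu2E; apply: (@ball_invariant_unique _ _ _ _ k) => //.
- move=> a l lk ak; rewrite !nu1E; congr (_ * _)%E.
  pose b : Qpd p_pr d := const_mx (a 0 0).
  have bk : padic_ball k 0 b by move=> j; have := ak 0; rewrite !mxE.
  rewrite -[RHS](hd.2 b); last first.
    apply: measurableI => //; rewrite -[X in measurable X]setTI.
    by apply: measurable_coord_row => //; exact: measurable_padic_ball.
  congr (mu_d _); apply/seteqP; split => [x [xa xk]|_ [x [xa xk] <-]].
    exists (x - b); last by rewrite addrC subrK.
    split; first by move=> j; have := xa 0; rewrite !mxE subr0.
    by move=> j; rewrite !mxE subr0; apply: padic_absB_le; [have := xk j|have := bk j]; rewrite !mxE subr0.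
  split; first by move=> j; have := xa 0; rewrite !mxE (ord1 j) subr0 addrAC subrr add0r.
  by move=> j; rewrite !mxE subr0; apply: padic_absD_le; [have := bk j|have := xk j]; rewrite !mxE subr0.
- move=> a l lk ak; rewrite !nu2E setIidl ?setIidl ?haar_ball//.
    exact: padic_ball_le.
  by rewrite -(padic_ball_eq ak); exact: padic_ball_le.
- move=> A mA A0; rewrite nu1E (_ : _ `&` _ = set0) ?measure0 ?mule0//.
  apply/seteqP; split => // x [xA /sub xk].
  have : (A `&` padic_ball k 0) (coord_row x) by [].
  by rewrite A0.
- by move=> A mA A0; rewrite nu2E A0 measure0 mule0.
- by rewrite ball1 nu2E setIid haar_ball// -EFinM -expfzDr// addNr expr0z.
- by rewrite ball1 ltry.
Qed.

End coordinate.

(** * The symbol as a mixture of indicators of balls *)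

(** Alternates between nonnegative and negative integers. Sums over Z become series
    over nat, to which monotone convergence applies. *)
Definition int_enum (n : nat) : int := if odd n then Negz n./2 else Posz n./2.

Lemma cvg_double : (fun n => n.*2) @ \oo --> \oo.
Proof.
move=> A [N _ NA]; exists N => // n /= Nn; apply: NA => /=.
by rewrite -addnn (leq_trans Nn) ?leq_addr.
Qed.

(** The left side is the subsequence of even partial sums, over the symmetric windows
    from - N to N - 1; a series of nonnegative terms converges along the whole sequence. *)
Lemma cvg_int_series (R : realType) (F : int -> R) : (forall k, 0 <= F k) ->
  (\sum_(j < N) (F j + F (Negz j)))%:E @[N --> \oo] -->
  (\sum_(n <oo) (F (int_enum n))%:E)%E.
Proof.
move=> F0.
have h : (\sum_(0 <= i < n) (F (int_enum i))%:E)%E @[n --> \oo] -->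
    (\sum_(n <oo) (F (int_enum n))%:E)%E.
  by apply: is_cvg_nneseries => n _ _; rewrite lee_fin.
have := cvg_comp _ _ cvg_double h.
apply: cvg_trans; apply: near_eq_cvg; apply: nearW => N /=.
elim: N => [|N IH]; first by rewrite big_geq// big_ord0.
rewrite doubleS !big_nat_recr//= IH big_ord_recr/= -addeA EFinD -EFinD.
by rewrite /int_enum /= odd_double /= doubleK uphalf_double.
Qed.

Section weights.
Variables (R : realType) (p : nat) (p_pr : prime p) (a b : R).
Hypotheses (a0 : 0 < a) (b0 : 0 < b).

Let r : R := p%:R `^ b.

Let p0 : (0 : R) < p%:R. Proof. by rewrite ltr0n prime_gt0. Qed.
Let p1 : (1 : R) < p%:R. Proof. by rewrite ltr1n prime_gt1. Qed.

Let r1 : 1 < r.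
Proof.
have -> : 1 = 1 `^ b :> R by rewrite powR1.
by rewrite gt0_ltr_powR// nnegrE// ltW.
Qed.
Let r0 : 0 < r. Proof. exact: lt_trans r1. Qed.

(** The value of the symbol on the sphere of radius p^k, see [level_value_powR]. *)
Definition level_value (k : int) : R := expR (- (a * r ^ k)).
Definition level_weight (k : int) : R := level_value k - level_value (k + 1).

Lemma level_value_powR (k : int) : level_value k = expR (- (a * (p%:R ^ k) `^ b)).
Proof.
rewrite /level_value /r; congr (expR (- (_ * _))).
by rewrite -(powR_intmul k (powR_ge0 _ _)) -(powR_intmul k (ltW p0)) -!powRrM mulrC.
Qed.

Lemma level_weight_ge0 k : 0 <= level_weight k.
Proof.
rewrite subr_ge0 ler_expR lerN2 ler_pM2l// ler_weXz2l ?(ltW r1)//.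
by rewrite lerDl.
Qed.

Lemma level_value_gt0 k : 0 < level_value k. Proof. exact: expR_gt0. Qed.

Lemma level_weight_le k : level_weight k <= level_value k.
Proof. by rewrite gerBl ltW// level_value_gt0. Qed.

Lemma level_value_le1 k : level_value k <= 1.
Proof. by rewrite expR_le1 oppr_le0 mulr_ge0 ?(ltW a0)// exprz_ge0// ltW. Qed.

(** The exponential beats every power: one term of its series is kept, of a degree M + 1
    so large that p^(b(M + 1)) is at least 2 q. *)
Lemma level_value_decay (q : R) : 0 <= q -> exists2 K : R, 0 <= K &
  forall j : nat, level_value j * q ^+ j <= K * 2^-1 ^+ j.
Proof.
move=> q0.
have [M qM] : exists M : nat, q / r ^+ M.+1 <= 2^-1.
  have : `|r^-1| < 1 by rewrite ger0_norm ?invr_ge0 ?(ltW r0)// invf_lt1.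
  move=> /cvg_expr/cvgrPdist_lt/(_ (2 * (q + 1))^-1).
  have q1 : 0 < 2 * (q + 1) by rewrite mulr_gt0// ltr_wpDl.
  rewrite invr_gt0 => /(_ q1)[M _ /(_ M.+1 (leqnSn M))].
  rewrite sub0r normrN ger0_norm ?exprn_ge0 ?invr_ge0 ?(ltW r0)// exprVn => h.
  exists M; apply: le_trans (ler_wpM2l q0 (ltW h)) _.
  by rewrite ler_pdivrMr//; lra.
exists (M.+1`!%:R / a ^+ M.+1).
  by rewrite mulr_ge0// invr_ge0 exprn_ge0// ltW.
move=> j; pose x := a * r ^+ j.
have x0 : 0 < x by rewrite mulr_gt0// exprn_gt0.
have H : level_value j <= M.+1`!%:R / x ^+ M.+1.
  rewrite /level_value -exprnP -/x expRN -[X in _ <= X]invrK lef_pV2 ?posrE ?expR_gt0//; last first.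
    by rewrite invr_gt0 divr_gt0// ?exprn_gt0// ltr0n fact_gt0.
  rewrite invf_div; apply: le_trans (expR_ge1Dxn M (ltW x0)).
  by rewrite lerDr.
apply: le_trans (ler_wpM2r (exprn_ge0 j q0) H) _.
have -> : M.+1`!%:R / x ^+ M.+1 * q ^+ j = M.+1`!%:R / a ^+ M.+1 * (q / r ^+ M.+1) ^+ j.
  by rewrite /x exprMn invfM expr_div_n -!exprM [(j * _)%N]mulnC; ring.
apply: ler_wpM2l; first by rewrite mulr_ge0// invr_ge0 exprn_ge0// ltW.
by rewrite lerXn2r// ?nnegrE// ?divr_ge0 ?exprn_ge0 ?(ltW r0).
Qed.

Lemma cvg_level_value_pinfty : level_value n%:Z @[n --> \oo] --> (0 : R).
Proof.
have [K K0 Kj] := level_value_decay ler01.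
apply: (@squeeze_cvgr _ _ _ _ (fun=> 0) (fun n => K * 2^-1 ^+ n)).
- near=> n; rewrite ltW ?level_value_gt0//=.
  by have := Kj n; rewrite expr1n mulr1.
- exact: cvg_cst.
- by apply: cvg_geometric; rewrite ger0_norm ?invr_ge0// invf_lt1// ltr1n.
Unshelve. all: by end_near. Qed.

Lemma cvg_level_value_ninfty : level_value (- n%:Z) @[n --> \oo] --> (1 : R).
Proof.
rewrite -expR0; apply: continuous_cvg; first exact: continuous_expR.
rewrite -oppr0; apply: cvgN.
rewrite (_ : (fun _ => _) = (geometric a r^-1)); last first.
  by apply/funext => n /=; rewrite -invr_expz exprVn.
by apply: cvg_geometric; rewrite ger0_norm ?invr_ge0 ?(ltW r0)// invf_lt1.
Qed.

Lemma telescope_int (h : int -> R) (N : nat) :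
  \sum_(j < N) ((h j - h (j%:Z + 1)) + (h (Negz j) - h (Negz j + 1))) = h (- N%:Z) - h N.
Proof.
elim: N => [|N IH]; first by rewrite big_ord0 oppr0 subrr.
rewrite big_ord_recr /= IH NegzE.
have -> : - N.+1%:Z + 1 = - N%:Z by rewrite intS; ring.
have -> : N%:Z + 1 = N.+1%:Z by rewrite intS addrC.
by rewrite addrCA addrA; lra.
Qed.

Variable d : nat.

Lemma max_norm_le (y : Qpd p_pr d) (k : int) :
  (max_norm y <= p%:R ^ k) <-> padic_ball k 0 y.
Proof.
split.
  move=> yk j; rewrite mxE subr0; apply: le_trans yk.
  exact: (le_bigmax _ (fun j => padic_abs (y 0 j))).
move=> h; apply/bigmax_leP; split=> [|j _].
  by rewrite exprz_ge0// ler0n.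
by have := h j; rewrite mxE subr0.
Qed.

Lemma max_norm_val (y : Qpd p_pr d) : max_norm y = 0 \/ exists m : int, max_norm y = p%:R ^ m.
Proof.
rewrite /max_norm; elim/big_ind : _; first by left.
  by move=> u v hu hv; rewrite maxEle; case: ifP.
move=> j _; have [->|/padic_abs_val] := eqVneq (y 0 j) 0; last by right.
by rewrite padic_abs0; left.
Qed.

(** If y has norm p^m, the balls that contain y are those with k >= m, and the sum
    telescopes to the value at level m. If y = 0 all balls count, and the sum is the
    limit at - oo of the level values, which is 1. *)
Lemma level_mixture (y : Qpd p_pr d) :
  (\sum_(n <oo) (level_weight (int_enum n) * \1_(padic_ball (int_enum n) 0) y)%:E)%E =
  (expR (- (a * ratr (max_norm y) `^ b)))%:E.
Proof.
have H (h : int -> R) L : h n%:Z @[n --> \oo] --> (0 : R) -> h (- n%:Z) @[n --> \oo] --> L ->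
    (forall k, h k - h (k + 1) = level_weight k * \1_(padic_ball k 0) y) ->
   (\sum_(n <oo) (level_weight (int_enum n) * \1_(padic_ball (int_enum n) 0) y)%:E)%E = L%:E.
  move=> h0 h1 hk.
  have := @cvg_int_series R (fun k => level_weight k * \1_(padic_ball k 0) y).
  move=> /(_ _)/cvg_lim <-//; last first.
    by move=> k; rewrite mulr_ge0// level_weight_ge0.
  apply: cvg_lim => //.
  under eq_fun do under eq_bigr do rewrite -!hk.
  under eq_fun do rewrite telescope_int.
  apply: cvg_EFin; first by near=> n.
  by rewrite /= -[L]subr0; exact: cvgB.
have [y0|[m ym]] := max_norm_val y.
  rewrite y0 rmorph0 powR0 ?gt_eqF// mulr0 oppr0 expR0.
  apply: (H level_value _ cvg_level_value_pinfty cvg_level_value_ninfty) => k.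
  rewrite indicE mem_set ?mulr1//; apply/max_norm_le.
  by rewrite y0 exprz_ge0// ler0n.
rewrite ym.
have -> : ratr (p%:R ^ m) = p%:R ^ m :> R by rewrite fmorphXz rmorph_nat.
rewrite -level_value_powR.
(* Truncating at m turns the restricted weights into increments of a function on Z. *)
apply: (H (fun k => level_value (Num.max m k))).
- apply: cvg_trans cvg_level_value_pinfty; apply: near_eq_cvg.
  exists `|m|%N => // n /= mn; rewrite max_r//.
  by apply: le_trans (ler_norm m) _; rewrite -abszE lez_nat.
- apply: cvg_near_cst; exists `|m|%N => // n /= mn; rewrite max_l//.
  rewrite lerNl; apply: le_trans (ler_norm (- m)) _; rewrite normrN.
  by rewrite -abszE lez_nat.
- move=> k; rewrite indicE.
  have -> : (y \in padic_ball k 0) = (m <= k).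
    apply/idP/idP => [|mk].
      by rewrite inE => /max_norm_le; rewrite ym ler_eXz2l// ltr1n prime_gt1.
    by apply/mem_set/max_norm_le; rewrite ym ler_eXz2l// ltr1n prime_gt1.
  have [mk|km] := leP m k.
    by rewrite max_r ?(le_trans mk) ?lerDl// mulr1.
  by rewrite max_l -?ltzD1 ?ltrD2r// subrr mulr0.
Unshelve. all: by end_near. Qed.

(** The total is the integral of the symbol. Large balls are controlled by the decay of
    the weights; for small ones the volume itself is summable, as d > 0. *)
Lemma level_mass_lty : (1 <= d)%N ->
  (\sum_(n <oo) (level_weight (int_enum n) * (p ^ d)%:R ^ (int_enum n))%:E < +oo)%E.
Proof.
move=> d1; set q : R := (p ^ d)%:R.
have q2 : 2 <= q.
  rewrite ler_nat; apply: leq_trans (prime_gt1 p_pr) _.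
  by rewrite -[X in (X <= _)%N]expn1 leq_pexp2l// prime_gt0.
have q0 : 0 < q by apply: lt_le_trans q2.
have [K K0 Kj] := level_value_decay (ltW q0).
have F0 k : 0 <= level_weight k * q ^ k.
  by rewrite mulr_ge0 ?level_weight_ge0// exprz_ge0// ltW.
rewrite -(cvg_lim _ (cvg_int_series F0))//.
apply: le_lt_trans (ltry (2 * (K + 1))); apply: lime_le.
  exact: cvgP (cvg_int_series F0).
apply: nearW => N; rewrite lee_fin.
have -> : 2 * (K + 1) = (K + 1) * 2 by rewrite mulrC.
have half : \sum_(j < N) (2^-1 : R) ^+ j <= 2.
  have : \sum_(j < N) (2^-1 : R) ^+ j = 2 - 2 * 2^-1 ^+ N.
    elim: N => [|N IH]; first by rewrite big_ord0 expr0; lra.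
    by rewrite big_ord_recr /= IH exprS; lra.
  by move=> ->; rewrite gerBl mulr_ge0// exprn_ge0// invr_ge0.
apply: le_trans (ler_wpM2l _ half); last by rewrite addr_ge0.
rewrite mulr_sumr; apply: ler_sum => j _; rewrite [leRHS]mulrDl mul1r; apply: lerD.
  apply: le_trans (Kj j); rewrite -exprnP ler_wpM2r ?exprn_ge0 ?(ltW q0)//.
  exact: level_weight_le.
rewrite NegzE -invr_expz -exprVn; apply: (@le_trans _ _ (1 * q^-1 ^+ j.+1)).
  apply: ler_wpM2r; first by rewrite exprn_ge0// invr_ge0 ltW.
  exact: le_trans (level_weight_le _) (level_value_le1 _).
rewrite mul1r exprS; apply: (@le_trans _ _ (1 * q^-1 ^+ j)).
  apply: ler_wpM2r; first by rewrite exprn_ge0// invr_ge0 ltW.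
  by rewrite invf_le1//; apply: le_trans q2; rewrite ler1n.
rewrite mul1r lerXn2r// ?nnegrE ?invr_ge0 ?(ltW q0)//.
by rewrite lef_pV2 ?posrE.
Qed.

End weights.

(** * The Fourier transform of a ball *)

Section ball_character.
Variables (R : realType) (p : nat) (p_pr : prime p) (d : nat).
Variable mu : {measure set (Qpd p_pr d) -> \bar R}.
Hypothesis hmu : is_normalized_haar mu.
Implicit Types (x y : Qpd p_pr d) (k m : int).

Lemma measurable_locally_constant (f : Qpd p_pr d -> R) k :
  (forall x y, padic_ball k x y -> f y = f x) -> measurable_fun setT f.
Proof.
move=> fk _ B _; rewrite setTI; apply: open_measurable_Qpd; apply: open_padic_ballP.
by move=> x Bx; exists k => y /fk; rewrite /preimage /= => ->.
Qed.

Lemma dotQpDr x y z : dotQp x (y + z) = dotQp x y + dotQp x z.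
Proof.
rewrite /dotQp -big_split /=; apply: eq_bigr => j _.
by rewrite !mxE mulrDr.
Qed.

Lemma dotQp_le1 k x y : padic_ball (- k) 0 x -> padic_ball k 0 y -> padic_abs (dotQp x y) <= 1.
Proof.
move=> xk yk; apply: padic_abs_sum_le => // j.
have p0 : (0 : rat) < p%:R by rewrite ltr0n prime_gt0.
rewrite padic_absM; have -> : 1 = p%:R ^ (- k) * p%:R ^ k :> rat.
  by rewrite -expfzDr ?gt_eqF// addNr expr0z.
by apply: ler_pM; rewrite ?padic_abs_ge0//; [have := xk j|have := yk j]; rewrite mxE subr0.
Qed.

Lemma padic_ball_exists x : exists k, padic_ball k 0 x.
Proof.
have [x0|[k xk]] := max_norm_val x; last by exists k; apply/max_norm_le; rewrite xk.
by exists 0; apply/max_norm_le; rewrite x0.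
Qed.

(** The dot product with x sends a small enough ball into Zp, where the character is
    trivial. *)
Lemma trig_locally_constant x : exists k, forall y z, padic_ball k y z ->
  cos (padic_angle R (dotQp x z)) = cos (padic_angle R (dotQp x y)) /\
  sin (padic_angle R (dotQp x z)) = sin (padic_angle R (dotQp x y)).
Proof.
have [k xk] := padic_ball_exists x; exists (- k) => y z yz.
have h : padic_abs (dotQp x (z - y)) <= 1.
  apply: (@dotQp_le1 (- k)); first by rewrite opprK.
  by move=> j; rewrite !mxE subr0; exact: yz.
have -> : dotQp x z = dotQp x y + dotQp x (z - y) by rewrite -dotQpDr addrC subrK.
rewrite cos_padic_angleD sin_padic_angleD cosD sinD.
by rewrite (cos_padic_angle1 R h) (sin_padic_angle0 R h) !mulr0 !mulr1 subr0 addr0.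
Qed.

Lemma measurable_cos_dot x : measurable_fun setT (fun y => cos (padic_angle R (dotQp x y))).
Proof.
have [k xk] := trig_locally_constant x.
by apply: (@measurable_locally_constant _ k) => y z /xk[].
Qed.

Lemma measurable_sin_dot x : measurable_fun setT (fun y => sin (padic_angle R (dotQp x y))).
Proof.
have [k xk] := trig_locally_constant x.
by apply: (@measurable_locally_constant _ k) => y z /xk[].
Qed.

Lemma integrable_ball (f : Qpd p_pr d -> R) k : measurable_fun setT f ->
  (forall y, `|f y| <= 1) -> mu.-integrable (padic_ball k 0) (EFin \o f).
Proof.
move=> mf f1; apply: measurable_bounded_integrable.
- exact: measurable_padic_ball.
- by rewrite haar_ball// ltry.
- exact: measurable_funTS.
- by exists 1; split => // M M1 y _ /=; apply: le_trans (ltW M1).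
Qed.

(** Invariance of the measure says that it equals its image under the translation. *)
Lemma Rintegral_ball_shift (f : Qpd p_pr d -> R) k a : measurable_fun setT f ->
  (forall y, `|f y| <= 1) -> padic_ball k 0 a ->
  \int[mu]_(y in padic_ball k 0) f y = \int[mu]_(y in padic_ball k 0) f (y + a).
Proof.
move=> mf f1 ak; pose phi (y : Qpd p_pr d) : Qpd p_pr d := y + a.
have phiE A : phi @^-1` A = [set - a + x | x in A].
  apply/seteqP; split => [y Ay|_ [x Ax <-]].
    by exists (phi y) => //; rewrite /phi addrC addrK.
  by rewrite /phi /preimage /= addrAC addNr add0r.
have mphi : measurable_fun setT phi.
  apply: (measurability (@open 'rV[Qp p_pr]_d : set (set (Qpd p_pr d)))) => //.
  move=> _ [U oU <-]; rewrite setTI; apply: open_measurable_Qpd.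
  apply: open_padic_ballP => y /(padic_ball_nbhs oU)[l lU]; exists l => z yz.
  by apply: lU => j; rewrite !mxE opprD addrACA subrr addr0.
have phiB : phi @^-1` padic_ball k 0 = padic_ball k 0.
  rewrite phiE padic_ball_shift addr0; apply: padic_ball_eq => j.
  by have := ak j; rewrite !mxE !subr0 padic_absN.
rewrite /Rintegral; congr fine.
transitivity (\int[pushforward mu phi]_(y in padic_ball k 0%R) (f y)%:E)%E.
  apply: eq_measure_integral => A mA _.
  by rewrite -(hmu.2 (- a) A mA) -phiE.
pose g (y : Qpd p_pr d) : \bar R := (f y)%:E.
have mg : measurable_fun setT g by exact/measurable_EFinP.
have ig : mu.-integrable (phi @^-1` padic_ball k 0) (g \o phi).
  rewrite phiB; apply: (integrable_ball k (f := f \o phi)).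
    exact: (measurableT_comp mf mphi).
  by move=> y; exact: f1.
have := integral_pushforward mphi mg ig (measurable_padic_ball _ _).
by rewrite phiB.
Qed.

Lemma Rintegral_ball_cos_in k x : padic_ball (- k) 0 x ->
  \int[mu]_(y in padic_ball k 0) cos (padic_angle R (dotQp x y)) = (p ^ d)%:R ^ k.
Proof.
move=> xk; rewrite (@eq_Rintegral _ _ _ _ _ (cst 1)); last first.
  by move=> y /set_mem yk /=; rewrite cos_padic_angle1//; exact: dotQp_le1 xk yk.
rewrite Rintegral_cst ?mul1r ?haar_ball//; exact: measurable_padic_ball.
Qed.

Lemma Rintegral_ball_sin_in k x : padic_ball (- k) 0 x ->
  \int[mu]_(y in padic_ball k 0) sin (padic_angle R (dotQp x y)) = 0.
Proof.
move=> xk; rewrite (@eq_Rintegral _ _ _ _ _ (cst 0)); last first.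
  by move=> y /set_mem yk /=; rewrite sin_padic_angle0//; exact: dotQp_le1 xk yk.
rewrite Rintegral_cst ?mul0r//; exact: measurable_padic_ball.
Qed.

(** Orthogonality of characters: translating by a point of the ball where the character
    is not 1 leaves the integral unchanged, yet multiplies it by the value there.
    In real coordinates, the vector (C, S) is fixed by a nontrivial rotation. *)
Lemma Rintegral_ball_out k x : ~ padic_ball (- k) 0 x ->
  \int[mu]_(y in padic_ball k 0) cos (padic_angle R (dotQp x y)) = 0 /\
  \int[mu]_(y in padic_ball k 0) sin (padic_angle R (dotQp x y)) = 0.
Proof.
move=> /existsNP[j /negP]; rewrite mxE subr0 -ltNge => xj.
have p0 : (0 : rat) < p%:R by rewrite ltr0n prime_gt0.
(* A vector of norm p^k whose product with x has absolute value |x_j| p^k > 1. *)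
pose a : Qpd p_pr d := \row_l if l == j then p%:R ^ (- k) else 0.
have ak : padic_ball k 0 a.
  move=> l; rewrite !mxE subr0; case: ifP => _; last by rewrite padic_abs0 exprz_ge0// ltW.
  by rewrite padic_abs_pX opprK.
have xa : dotQp x a = x 0 j * p%:R ^ (- k).
  rewrite /dotQp (bigD1 j)//= mxE eqxx big1 ?addr0// => l lj.
  by rewrite mxE (negbTE lj) mulr0.
have xa1 : 1 < padic_abs (dotQp x a).
  rewrite xa padic_absM padic_abs_pX opprK -ltr_pdivrMr ?exprz_gt0// mul1r.
  by rewrite invr_expz.
set C := Rintegral _ _ _; set S := Rintegral _ _ _.
set c := cos (padic_angle R (dotQp x a)); set s := sin (padic_angle R (dotQp x a)).
have c1 : c != 1 by exact: cos_padic_angle_neq1.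
have mb : measurable (padic_ball k 0 : set (Qpd p_pr d)) by exact: measurable_padic_ball.
have iC := integrable_ball k (measurable_cos_dot x) (fun y => cos_max _).
have iS := integrable_ball k (measurable_sin_dot x) (fun y => sin_max _).
have iZ r f : mu.-integrable (padic_ball k 0) (EFin \o f) ->
    mu.-integrable (padic_ball k 0) (EFin \o (fun y => f y * r)).
  move=> fi; rewrite (_ : _ \o _ = fun y => (r%:E * (EFin \o f) y)%E).
    exact: integrableZl.
  by apply/funext => y /=; rewrite -EFinM mulrC.
have EC : C = C * c - S * s.
  rewrite {1}/C (Rintegral_ball_shift (measurable_cos_dot x) _ ak); last by move=> y; exact: cos_max.
  under eq_Rintegral do rewrite dotQpDr cos_padic_angleD cosD.
  by rewrite RintegralB ?RintegralZr//; exact: iZ.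
have ES : S = S * c + C * s.
  rewrite {1}/S (Rintegral_ball_shift (measurable_sin_dot x) _ ak); last by move=> y; exact: sin_max.
  under eq_Rintegral do rewrite dotQpDr sin_padic_angleD sinD.
  by rewrite RintegralD ?RintegralZr//; exact: iZ.
have D0 : (1 - c) ^+ 2 + s ^+ 2 != 0.
  rewrite gt_eqF// ltr_pwDl ?sqr_ge0// exprn_even_gt0//= subr_eq0 eq_sym//.
have C0 : ((1 - c) ^+ 2 + s ^+ 2) * C = 0.
  have h1 : (1 - c) * C = - (S * s) by rewrite mulrBl mul1r {1}EC; ring.
  have h2 : (1 - c) * S = C * s by rewrite mulrBl mul1r {1}ES; ring.
  have -> : ((1 - c) ^+ 2 + s ^+ 2) * C = (1 - c) * ((1 - c) * C) + s * (C * s) by ring.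
  by rewrite h1 -h2; ring.
have S0 : ((1 - c) ^+ 2 + s ^+ 2) * S = 0.
  have h1 : (1 - c) * C = - (S * s) by rewrite mulrBl mul1r {1}EC; ring.
  have h2 : (1 - c) * S = C * s by rewrite mulrBl mul1r {1}ES; ring.
  have -> : ((1 - c) ^+ 2 + s ^+ 2) * S = (1 - c) * ((1 - c) * S) - s * (- (S * s)) by ring.
  by rewrite h2 -h1; ring.
by move: C0 S0 => /eqP + /eqP; rewrite !mulf_eq0 (negbTE D0) => /eqP -> /eqP ->.
Qed.

End ball_character.

(** * The fundamental solution as a mixture of uniform laws *)

Section fundamental_solution.
Variables (R : realType) (p : nat) (p_pr : prime p) (d : nat).
Variable mu : {measure set (Qpd p_pr d) -> \bar R}.
Hypotheses (d1 : (1 <= d)%N) (hmu : is_normalized_haar mu).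
Variables (a b : R).
Hypotheses (a0 : 0 < a) (b0 : 0 < b).

Local Notation w n := (level_weight p a b (int_enum n)).
Local Notation B n := (padic_ball (int_enum n) (0 : Qpd p_pr d)).
Local Notation q n := ((p ^ d)%:R ^ (int_enum n) : R).

Definition symbol (y : Qpd p_pr d) : R := expR (- (a * ratr (max_norm y) `^ b)).

Let mB n : measurable (B n). Proof. exact: measurable_padic_ball. Qed.
Let w0 n : 0 <= w n. Proof. exact: level_weight_ge0. Qed.
Let q0 n : 0 <= q n. Proof. by rewrite exprz_ge0. Qed.

Lemma integral_level_mixture (G : Qpd p_pr d -> R) :
  measurable_fun setT G -> (forall y, 0 <= G y) ->
  (\int[mu]_y (G y * symbol y)%:E =
   \sum_(n <oo) ((w n)%:E * \int[mu]_(y in B n) (G y)%:E))%E.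
Proof.
move=> mG G0.
have mI n : measurable_fun setT (fun y => G y * (w n * \1_(B n) y)).
  by apply: measurable_funM => //; apply: measurable_funM.
rewrite (eq_integral (fun y => \sum_(n <oo) (G y * (w n * \1_(B n) y))%:E)%E); last first.
  move=> y _; rewrite EFinM -(level_mixture a0 b0) -nneseriesZl//.
  by move=> n _; rewrite lee_fin mulr_ge0.
rewrite integral_nneseries//.
- apply: eq_eseriesr => n _; rewrite [in RHS]integral_mkcond.
  rewrite -ge0_integralZl_EFin//.
  + apply: eq_integral => y _; rewrite patchE indicE.
    by case: ifPn => _; rewrite ?mulr1 ?mulr0 ?mule0// mulrC EFinM.
  + by move=> y _; rewrite patchE; case: ifPn => // _; rewrite lee_fin.
  + by apply/(measurable_restrictT _ (mB n)); apply/measurable_EFinP; exact: measurable_funTS.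
- by move=> n; exact/measurable_EFinP.
- by move=> n y _; rewrite lee_fin !mulr_ge0.
Qed.

Lemma measurable_symbol : measurable_fun setT symbol.
Proof.
apply/measurable_EFinP.
rewrite (_ : _ \o _ = fun y => \sum_(n <oo) (w n * \1_(B n) y)%:E)%E; last first.
  by apply/funext => y; rewrite level_mixture.
apply: ge0_emeasurable_sum => [n y _ _|n _]; first by rewrite lee_fin mulr_ge0.
by apply/measurable_EFinP; apply: measurable_funM.
Qed.

Lemma symbol_ge0 y : 0 <= symbol y. Proof. exact: expR_ge0. Qed.

Lemma integral_symbol : (\int[mu]_y (symbol y)%:E = \sum_(n <oo) (w n * q n)%:E)%E.
Proof.
have := @integral_level_mixture (cst 1) (measurable_cst _) (fun=> ler01).
under eq_integral do rewrite mul1r.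
move=> ->; apply: eq_eseriesr => n _.
rewrite EFinM -(haar_ball hmu (int_enum n) 0) -[X in _ = (_ * X)%E]mul1e.
by congr (_ * _)%E; exact: (integral_cst mu (mB n) 1%E).
Qed.

(** Monotone convergence needs a nonnegative integrand, so it is applied to 1 + h and
    to 1. Subtraction is possible because the symbol is integrable. *)
Lemma integral_trig_symbol (h : Qpd p_pr d -> R) (v : nat -> R) :
  measurable_fun setT h -> (forall y, `|h y| <= 1) -> (forall n, 0 <= v n <= 1) ->
  (forall n, \int[mu]_(y in B n) h y = v n * q n) ->
  (\int[mu]_y (h y * symbol y)%:E = \sum_(n <oo) (w n * (q n * v n))%:E)%E.
Proof.
move=> mh h1 v01 hv.
have v0 n : 0 <= v n by case/andP: (v01 n).
have wq0 n : 0 <= w n * q n by rewrite mulr_ge0.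
have wqv0 n : 0 <= w n * (q n * v n) by rewrite mulr_ge0// mulr_ge0.
set Z := (\sum_(n <oo) (w n * q n)%:E)%E; set V := (\sum_(n <oo) (w n * (q n * v n))%:E)%E.
have Zoo : (Z < +oo)%E := level_mass_lty p_pr a0 b0 d1.
have Voo : (V < +oo)%E.
  apply: le_lt_trans Zoo; apply: lee_nneseries => [n _|n _]; first by rewrite lee_fin.
  rewrite lee_fin; apply: ler_wpM2l => //; rewrite ler_piMr//.
  by case/andP: (v01 n).
have m1h : measurable_fun setT (fun y => 1 + h y) by exact: measurable_funD.
have h0 y : 0 <= 1 + h y.
  by have := h1 y; rewrite ler_norml => /andP[? _]; rewrite -lerBlDl sub0r.
have E1 : (\int[mu]_y ((1 + h y) * symbol y)%:E = Z + V)%E.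
  rewrite integral_level_mixture// -nneseriesD//; last 2 first.
    by move=> n _ _; rewrite lee_fin.
    by move=> n _ _; rewrite lee_fin.
  apply: eq_eseriesr => n _; rewrite -EFinD -mulrDr EFinM; congr (_ * _)%E.
  have i1 : mu.-integrable (B n) (EFin \o (cst 1)).
    by apply: integrable_ball => // y; rewrite normr1.
  have ih : mu.-integrable (B n) (EFin \o h) by exact: integrable_ball.
  have i1h : mu.-integrable (B n) (EFin \o (fun y => 1 + h y)).
    by have := integrableD (mB n) i1 ih; apply: eq_integrable => // y _; rewrite /= EFinD.
  rewrite -[LHS]fineK; last exact: integrable_fin_num.
  congr EFin; rewrite -[LHS]/(Rintegral _ _ _) RintegralD// hv Rintegral_cst// mul1r.
  by rewrite haar_ball//= [v n * _]mulrC.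
have is0 : mu.-integrable setT (EFin \o symbol).
  apply/integrableP; split; first by apply/measurable_EFinP; exact: measurable_symbol.
  under eq_integral do rewrite /= ger0_norm ?symbol_ge0//.
  by rewrite integral_symbol.
have is1 : mu.-integrable setT (EFin \o (fun y => (1 + h y) * symbol y)).
  apply/integrableP; split.
    by apply/measurable_EFinP/measurable_funM => //; exact: measurable_symbol.
  under eq_integral do rewrite /= ger0_norm ?mulr_ge0 ?symbol_ge0//.
  by rewrite E1 lte_add_pinfty.
rewrite (eq_integral (fun y => ((1 + h y) * symbol y)%:E - (symbol y)%:E)%E); last first.
  by move=> y _; rewrite -EFinB mulrDl mul1r addrAC subrr add0r.
rewrite integralB_EFin// E1 integral_symbol -/Z addeAC subee ?add0e//.
by rewrite ge0_fin_numE// nneseries_ge0// => n _ _; rewrite lee_fin.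
Qed.

(** By orthogonality the ball of radius p^k contributes its volume if x lies in the dual
    ball of radius p^(- k), and nothing otherwise. The sine
    integrates to 0 over every ball, so the imaginary part vanishes. *)
Lemma rhoE (sigma t : R) (x : Qpd p_pr d) : sigma * t = a ->
  rho mu sigma b t x =
  Complex (fine (\sum_(n <oo) (w n * (q n * \1_(padic_ball (- int_enum n) 0%R) x))%:E)%E) 0.
Proof.
move=> sta; rewrite /rho /Cintegral; congr Complex.
- rewrite /Rintegral; congr fine.
  rewrite -(@integral_trig_symbol (fun y => cos (padic_angle R (dotQp x y)))).
  + apply: eq_integral => y _ /=.
    by rewrite mulr0 subr0 /symbol -sta !mulNr.
  + exact: measurable_cos_dot.
  + by move=> y; exact: cos_max.
  + by move=> n; rewrite indicE; case: (_ \in _); rewrite ?ler01 ?lexx.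
  + move=> n; rewrite indicE; case: (boolP (_ \in _)) => [/set_mem xn|/negP xn].
      by rewrite mul1r Rintegral_ball_cos_in.
    rewrite mul0r (Rintegral_ball_out hmu _).1// => h; apply: xn; exact/mem_set.
- rewrite /Rintegral.
  rewrite [X in fine X](_ : _ = \int[mu]_y (sin (padic_angle R (dotQp x y)) * symbol y)%:E)%E; last first.
    apply: eq_integral => y _ /=.
    by rewrite mulr0 add0r /symbol -sta !mulNr.
  rewrite (@integral_trig_symbol _ (fun=> 0)).
  + by rewrite eseries0// => n _ _; rewrite !mulr0.
  + exact: measurable_sin_dot.
  + by move=> y; exact: sin_max.
  + by move=> n; rewrite lexx ler01.
  + move=> n; rewrite mul0r; have [xn|xn] := pselect (padic_ball (- int_enum n) 0 x).
      by rewrite Rintegral_ball_sin_in.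
    by rewrite (Rintegral_ball_out hmu xn).2.
Qed.

(** Since [q n] is the inverse of the volume of the ball of radius p^(- k), the nth summand
    is the weight times the mass of A under the uniform law on that ball. *)
Lemma Cintegral_rho (sigma t : R) (A : set (Qpd p_pr d)) : sigma * t = a -> measurable A ->
  Cintegral mu A (rho mu sigma b t) =
  Complex (fine (\sum_(n <oo) ((w n)%:E * ((q n)%:E * mu (A `&` padic_ball (- int_enum n) 0%R))))%E) 0.
Proof.
move=> sta mA; rewrite /Cintegral; congr Complex; last first.
  rewrite /Rintegral (eq_integral (fun=> 0%E)) ?integral0//.
  by move=> x _; rewrite (rhoE x sta).
rewrite /Rintegral; congr fine.
have t0 n x : 0 <= w n * (q n * \1_(padic_ball (- int_enum n) 0) x).
  by rewrite mulr_ge0// mulr_ge0.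
have mb n : measurable (padic_ball (- int_enum n) (0 : Qpd p_pr d)) by exact: measurable_padic_ball.
rewrite (eq_integral (fun x => \sum_(n <oo)
    (w n * (q n * \1_(padic_ball (- int_enum n) 0%R) x))%:E)%E); last first.
  move=> x _; rewrite (rhoE x sta) /= fineK//.
  rewrite ge0_fin_numE; last by apply: nneseries_ge0 => n _ _; rewrite lee_fin.
  apply: le_lt_trans (level_mass_lty p_pr a0 b0 d1).
  apply: lee_nneseries => [n _|n _]; first by rewrite lee_fin.
  by rewrite lee_fin; apply: ler_wpM2l => //; rewrite ler_piMr//.
rewrite integral_nneseries//.
- apply: eq_eseriesr => n _.
  under eq_integral do rewrite mulrA EFinM.
  rewrite ge0_integralZl_EFin//; last by rewrite mulr_ge0.
    by rewrite integral_indic// EFinM muleA setIC.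
  by apply/measurable_EFinP; exact: measurable_funTS.
- by move=> n; apply/measurable_EFinP; apply: measurable_funM => //; apply: measurable_funM.
- by move=> n x _; rewrite lee_fin.
Qed.

End fundamental_solution.

(** * The component process *)

Section component_path.
Variables (R : realType) (p : nat) (p_pr : prime p) (d : nat) (i : 'I_d).

Lemma cadlag_comp (V W : topologicalType) (f : V -> W) (u : {nonneg R} -> V) :
  continuous f -> cadlag u -> cadlag (f \o u).
Proof.
move=> cf [ur ul]; split=> [t|t t0]; first exact: cvg_comp (ur t) (cf _).
by have [l ult] := ul t t0; exists (f l); exact: cvg_comp ult (cf _).
Qed.

Definition component_path (w : skorohod R p_pr d) : skorohod R p_pr 1 :=
  CadlagPath (cadlag_comp (continuous_coord_row (i:=i)) (path_cadlag w)).

Lemma measurable_coord_process n (t : {nonneg R}) (B : set (Qpd p_pr n)) :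
  measurable B -> measurable [set w : skorohod R p_pr n | B (coord_process t w)].
Proof. by move=> mB; apply: sub_sigma_algebra; exists t, B. Qed.

Lemma measurable_coord_row_preimage (B : set (Qpd p_pr 1)) : measurable B ->
  measurable (coord_row i @^-1` B : set (Qpd p_pr d)).
Proof.
by move=> mB; rewrite -[X in measurable X]setTI; exact: measurable_coord_row.
Qed.

Lemma measurable_Qpd_origin n : measurable ([set 0] : set (Qpd p_pr n)).
Proof.
rewrite -[X in measurable X]setCK; apply: measurableC; apply: open_measurable_Qpd.
apply: open_padic_ballP => x x0.
have [j xj] : exists j, x 0 j != 0.
  apply: contrapT => /forallNP h; apply: x0; apply/rowP => j; rewrite mxE.
  by apply/eqP/negPn/negP; exact: h.
have [k kx] := padic_expz_small p_pr (padic_abs_gt0 xj).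
exists k => y xy y0; have := xy j; rewrite y0 mxE sub0r padic_absN.
by rewrite leNgt kx.
Qed.

Lemma measurable_component_path : measurable_fun setT component_path.
Proof.
apply: (measurability (@path_cylinder R p p_pr 1 : set (set (skorohod R p_pr 1)))) => //.
move=> _ [_ [t [B [mB ->]]] <-]; rewrite setTI.
exact: (measurable_coord_process t (measurable_coord_row_preimage mB)).
Qed.

HB.instance Definition _ := isMeasurableFun.Build _ _ _ _ component_path
  measurable_component_path.

Lemma increment_component_path (s t : {nonneg R}) (w : skorohod R p_pr d) :
  increment s t (component_path w) = coord_row i (increment s t w).
Proof. by apply/rowP => j; rewrite !mxE. Qed.

End component_path.

Theorem theorem3p1 (R : realType) (p : nat) (p_pr : prime p) (d : nat)
    (sigma b : R)
    (mu_d : {measure set (Qpd p_pr d) -> \bar R})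
    (mu_1 : {measure set (Qpd p_pr 1) -> \bar R})
    (P : probability (skorohod R p_pr d) R) :
  (1 <= d)%N -> 0 < sigma -> 0 < b ->
  is_normalized_haar mu_d -> is_normalized_haar mu_1 ->
  is_max_norm_law mu_d sigma b P ->
  forall i : 'I_d,
    is_brownian_motion mu_1 sigma b P (fun t w => coord_process t w 0 i).
Proof.
move=> d1 sigma0 b0 hd h1 [P0 Pind Pdens] i.
exists (component_path i : {mfun _ >-> _}); split => //.
have mrow := @measurable_coord_row_preimage p p_pr d i.
have incE (s t : {nonneg R}) (B : set (Qpd p_pr 1)) :
    component_path i @^-1` [set w | B (increment s t w)] =
    [set w | (coord_row i @^-1` B) (increment s t w)].
  by apply/seteqP; split => w /=; rewrite increment_component_path.
have m0 n : measurable [set w : skorohod R p_pr n | coord_process 0%:nng w = 0].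
  rewrite (_ : mkset _ = [set w : skorohod R p_pr n |
    ([set 0] : set (Qpd p_pr n)) (coord_process 0%:nng w)])//.
  by apply: measurable_coord_process; exact: measurable_Qpd_origin.
split.
- apply/eqP; rewrite eq_le; apply/andP; split; first exact: probability_le1.
  rewrite -[X in (X <= _)%E]P0; apply: le_measure; rewrite ?inE//.
    by rewrite -[X in measurable X]setTI; exact: measurable_component_path.
  by move=> w /= w0; apply/rowP => j; rewrite !mxE -[path_fun w _]/(coord_process 0%:nng w) w0 mxE.
- move=> n s t B st disj mB.
  have := Pind n s t (fun k => coord_row i @^-1` B k) st disj (fun k => mrow _ (mB k)).
  rewrite (_ : mkset _ = component_path i @^-1`
    [set w | forall k, B k (increment (s k) (t k) w)]); last first.
    by apply/seteqP; split => w /= h k; have := h k; rewrite increment_component_path.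
  by move=> h; apply: (etrans h); apply: eq_bigr => k _; rewrite -incE.
- move=> s t B st mB.
  have := Pdens s t _ st (mrow _ mB).
  have a0 : 0 < sigma * (t%:num - s%:num) by rewrite mulr_gt0// subr_gt0.
  rewrite !(Cintegral_rho _ _ a0 b0 erefl)//; last exact: mrow.
  rewrite -incE => h; apply: (etrans h); congr Complex; congr fine.
  apply: eq_eseriesr => n _; congr (_ * _)%E.
  by have := haar_coord i (- int_enum n) hd h1 mB; rewrite opprK.
Qed.
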